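(* Let $m=3$, let $n$ be a positive integer and let $\sigma_1,\sigma_2,\dots,\sigma_n$ be distinct positive constants. Fix $\hat x\in\mathbb{S}^2$ with $\hat x\neq d$, and let $\tau$ be a real constant with $\tau\notin\left\{\frac{\ell\pi}{k(1-\hat x\cdot d)}:\ell\in\mathbb{Z}\right\}$. For $t>0$ let $t_j=\sigma_jt+c_j$ and $\tilde t_j=t_j+\tau$ ($j=1,\dots,n$), where $c_1\geq0$ is arbitrarily fixed and, for $j\ge2$, $c_j\in\left[0,\frac{2\pi}{k(1-\hat x\cdot d)}\right)$ is such that $t_j-t_1\in\left\{\frac{2\ell\pi}{k(1-\hat x\cdot d)}:\ell\in\mathbb{Z}\right\}$ for each $t$. Define $F_{j,H}$ and $\widetilde F_{j,H}$ by $$\begin{pmatrix}F_{1,H}\\ \vdots\\ F_{n,H}\end{pmatrix}=V(t_1,\dots,t_n)^{-1}\begin{pmatrix}t_1[|u(t_1\hat x,d)|^2-1]\\ \vdots\\ t_n[|u(t_n\hat x,d)|^2-1]\end{pmatrix},\qquad \begin{pmatrix}\widetilde F_{1,H}\\ \vdots\\ \widetilde F_{n,H}\end{pmatrix}=V(\tilde t_1,\dots,\tilde t_n)^{-1}\begin{pmatrix}\tilde t_1[|u(\tilde t_1\hat x,d)|^2-1]\\ \vdots\\ \tilde t_n[|u(\tilde t_n\hat x,d)|^2-1]\end{pmatrix},$$ where $V(s_1,\dots,s_n)$ is the $n\times n$ matrix whose $(i,j)$ entry is $s_i^{-(j-1)}$. Define recursively for $j=1,\dots,n$ $$W_{j,H}=F_{j,H}-\sum_{\ell=1}^{j-1}\tilde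 f_\ell(\hat x)\overline{\tilde f_{j-\ell}(\hat x)},\qquad \widetilde W_{j,H}=\widetilde F_{j,H}-\sum_{\ell=1}^{j-1}\tilde f_\ell(\hat x)\overline{\tilde f_{j-\ell}(\hat x)},$$ $$\begin{pmatrix}\tilde f_j(\hat x)\\ \overline{\tilde f_j(\hat x)}\end{pmatrix}=\begin{pmatrix}e^{it_1k(1-\hat x\cdot d)}&e^{it_1k(\hat x\cdot d-1)}\\ e^{i(t_1+\tau)k(1-\hat x\cdot d)}&e^{i(t_1+\tau)k(\hat x\cdot d-1)}\end{pmatrix}^{-1}\begin{pmatrix}W_{j,H}\\ \widetilde W_{j,H}\end{pmatrix}$$ (empty sums are zero). Then, for $j=1,2,\dots,n$, $$\left(f_j(\hat x),\overline{f_j(\hat x)}\right)^\top=\left(\tilde f_j(\hat x),\overline{\tilde f_j(\hat x)}\right)^\top+O\left(\frac1{t^{n+1-j}}\right)\quad\text{as }t\to\infty.$$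
   Context: Let $m=3$, $k>0$, and let $D\subset\mathbb{R}^3$ be a bounded domain with boundary $\partial D$ of class $C^{3,\alpha}$ which is the open complement of an unbounded domain. $\nu$ is the unit exterior normal on $\partial D$. Fix $d\in\mathbb{S}^2$. The incident field is $u^i(x,d)=e^{ikx\cdot d}$; the total field $u=u^i+u^s$ satisfies $\Delta^2u-k^4u=0$ in $\mathbb{R}^3\setminus\overline D$, $\mathscr{B}u=(0,0)$ on $\partial D$ with $\mathscr{B}u$ one of $(u,\partial_\nu u)$, $(u,\Delta u)$, $(\Delta u,\partial_\nu\Delta u)$, $(u,\partial_\nu\Delta u)$, $(\partial_\nu u,\Delta u)$, $(\partial_\nu u,\partial_\nu\Delta u)$, and $\lim_{r\to\infty}r\left(\partial_ru^s-iku^s\right)=0$, $r=|x|$, uniformly in all directions. Set $u_H:=\frac12(u^s-\Delta u^s/k^2)$ and $u_M:=\frac12(u^s+\Delta u^s/k^2)$, so $u^s=u_H+u_M$, $\Delta u_H+k^2u_H=0$, $\Delta u_M-k^2u_M=0$ in $\mathbb{R}^3\setminus\overline D$, and both satisfy the same radiation condition. The functions $f_j$ on $\mathbb{S}^2$ are the coefficients of the Atkinson-type expansion of $u_H=u_H(\cdot,d)$: for every $N\in\mathbb{N}$, $$u_H(x)=\frac{e^{ik|x|}}{|x|}\left\{\sum_{j=1}^N\frac{f_j(\hat x)}{|x|^{j-1}}+O\left(\frac1{|x|^N}\right)\right\},\quad|x|\to\infty,\ \hat x=x/|x|;$$ in particular $f_1=u_H^\infty$ is the far-field pattern of $u_H$.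 *)

(* Defs.v *)
From HB Require Import structures.
From mathcomp Require Import all_boot all_order all_algebra.
From mathcomp Require Import all_classical all_reals all_analysis.
From mathcomp Require Import complex.
From mathcomp Require Import ring lra.

Set Implicit Arguments.
Unset Strict Implicit.
Unset Printing Implicit Defensive.

Import Order.TTheory GRing.Theory Num.Theory.
Import numFieldNormedType.Exports.

Local Open Scope classical_set_scope.
Local Open Scope ring_scope.
Local Open Scope complex_scope.

(* The norm that the library puts on ['rV[R]_n] is the sup norm: it is used
   here only through the topology it induces. Lengths are measured by [enorm],
   and moduli of complex numbers by the real-valued [normc]. *)
Notation normc := ComplexField.Normc.normc.

Section EuclideanSpace.
Context {R : realType}.

Definition dot n (x y : 'rV[R]_n) : R := \sum_i x 0 i * y 0 i.

Definition enorm n (x : 'rV[R]_n) : R := Num.sqrt (dot x x).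

Definition eball n (x : 'rV[R]_n) (r : R) : set 'rV[R]_n :=
  [set y | enorm (y - x) < r].

Definition dir n (x : 'rV[R]_n) : 'rV[R]_n := (enorm x)^-1 *: x.

Definition basis n (i : 'I_n) : 'rV[R]_n := delta_mx 0 i.

(* The filter |x| -> oo; limits along it are uniform in the direction x/|x|. *)
Definition infty_nbhs : set_system 'rV[R]_3 :=
  [set P | exists r : R, forall x, r <= enorm x -> P x].

Global Instance infty_nbhs_filter : ProperFilter infty_nbhs.
Proof.
apply: Build_ProperFilter_ex => [P [r Pr]|].
  exists (Num.max r 0 *: basis ord0); apply: Pr.
  rewrite /enorm /dot !big_ord_recl big_ord0 !mxE /= !mulr0 !addr0 mulr1.
  by rewrite -expr2 sqrtr_sqr ger0_norm le_max lexx ?orbT.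
split=> [|P Q [r Pr] [s Qs]|P Q PQ [r Pr]].
- by exists 0.
- exists (Num.max r s) => x; rewrite ge_max => /andP[rx sx].
  by split; [exact: Pr|exact: Qs].
- by exists r => x rx; apply: PQ; exact: Pr.
Qed.

End EuclideanSpace.

(* f = O(e) along F. The library's ['O_F] does not apply, since R[i] carries no
   normed R-module structure. *)
Definition bigO_at {R : realType} {T : Type} (F : set_system T)
    (f : T -> R[i]) (e : T -> R) : Prop :=
  exists M : R, \forall x \near F, normc (f x) <= M * e x.

Section Regularity.
Context {R : realType} {n : nat}.
Implicit Types (U : set 'rV[R]_n.+1) (g : 'rV[R]_n.+1 -> R).

Definition iter_partial (s : seq 'I_n.+1) g : 'rV[R]_n.+1 -> R :=
  foldr (fun i h => 'D_(basis i) h) g s.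

Definition grad g (x : 'rV[R]_n.+1) : 'rV[R]_n.+1 :=
  \row_i 'D_(basis i) g x.

(* U is meant to be open *)
Definition class_C (m : nat) U g : Prop :=
  forall s, (size s <= m)%N ->
    (forall x, U x -> {for x, continuous (iter_partial s g)}) /\
    ((size s < m)%N ->
       forall i x, U x -> derivable (iter_partial s g) x (basis i)).

Definition class_C_holder (m : nat) (al : R) U g : Prop :=
  class_C m U g /\
  forall s, size s = m -> exists H : R, forall y z, U y -> U z ->
    `|iter_partial s g y - iter_partial s g z| <= H * enorm (y - z) `^ al.

End Regularity.

Section Obstacle.
Context {R : realType}.
Implicit Types (D E : set 'rV[R]_3) (x v : 'rV[R]_3).

Definition domain E : Prop := [/\ E !=set0, open E & connected E].

Definition bdry D : set 'rV[R]_3 := closure D `\` interior D.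

Definition exterior D : set 'rV[R]_3 := ~` closure D.

(* Near x0, D is the set where the coordinate i, up to the sign (-1)^s, lies
   above the graph of the function [ga] of the two other coordinates. *)
Definition graph_chart D (al : R) x0 (i : 'I_3) (s : bool)
    (ga : 'rV[R]_2 -> R) (r : R) : Prop :=
  [/\ 0 < r,
      class_C_holder 3 al (eball (col' i x0 : 'rV[R]_2) r) ga &
      forall y, eball x0 r y -> (D y <-> ga (col' i y) < (-1) ^+ s * y 0 i)].

Definition boundary_C3 (al : R) D : Prop :=
  forall x0, bdry D x0 -> exists i s ga r, graph_chart D al x0 i s ga r.

(* In a chart, D is the set where [ga (col' i y) - (-1) ^+ s * y 0 i] is
   negative, so the gradient of that function points out of D. *)
Definition exterior_unit_normal (al : R) D x v : Prop :=
  exists i s ga r, graph_chart D al x i s ga r /\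
    v = dir (grad (fun y => ga (col' i y) - (-1) ^+ s * y 0 i) x).

Definition obstacle (al : R) D : Prop :=
  [/\ domain D, bounded_set D, boundary_C3 al D &
      exists E, [/\ domain E, ~ bounded_set E & D = ~` closure E]].

End Obstacle.

Section Fields.
Context {R : realType}.
Implicit Types (u : 'rV[R]_3 -> R[i]) (x v d : 'rV[R]_3) (k : R).

Definition cexpi (a : R) : R[i] := cos a +i* sin a.

Definition cderive v u x : R[i] :=
  'D_v (fun y => complex.Re (u y)) x +i* 'D_v (fun y => complex.Im (u y)) x.

Definition laplacian u x : R[i] :=
  \sum_(i < 3) cderive (basis i) (cderive (basis i) u) x.

Definition cclass_C (m : nat) (U : set 'rV[R]_3) u : Prop :=
  class_C m U (fun y => complex.Re (u y)) /\
  class_C m U (fun y => complex.Im (u y)).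

Definition plane_wave k d x : R[i] := cexpi (k * dot x d).

Definition total_field k d us x : R[i] := plane_wave k d x + us x.

Definition biharmonic_wave k (U : set 'rV[R]_3) u : Prop :=
  forall x, U x -> laplacian (laplacian u) x - (k ^+ 4)%:C * u x = 0.

Definition radiating k u : Prop :=
  (enorm x * normc (cderive (dir x) u x - 'i * k%:C * u x))
    @[x --> infty_nbhs] --> (0 : R).

Inductive boundary_operator := Trace | Normal | Lap | NormalLap.

Inductive boundary_condition :=
  | Trace_Normal | Trace_Lap | Lap_NormalLap
  | Trace_NormalLap | Normal_Lap | Normal_NormalLap.

Definition operators (B : boundary_condition) :=
  match B with
  | Trace_Normal => (Trace, Normal)
  | Trace_Lap => (Trace, Lap)
  | Lap_NormalLap => (Lap, NormalLap)
  | Trace_NormalLap => (Trace, NormalLap)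
  | Normal_Lap => (Normal, Lap)
  | Normal_NormalLap => (Normal, NormalLap)
  end.

Definition directional (b : boundary_operator) v u : 'rV[R]_3 -> R[i] :=
  match b with
  | Trace => u
  | Normal => cderive v u
  | Lap => laplacian u
  | NormalLap => cderive v (laplacian u)
  end.

(* Boundary values are limits from the exterior, with the normal frozen at the
   boundary point. *)
Definition vanishes_on_bdry (D : set 'rV[R]_3) (nu : 'rV[R]_3 -> 'rV[R]_3)
    (b : boundary_operator) u : Prop :=
  forall x, bdry D x ->
    (normc (directional b (nu x) u y)) @[y --> within (exterior D) (nbhs x)]
      --> (0 : R).

Definition satisfies_bc D nu (B : boundary_condition) u : Prop :=
  vanishes_on_bdry D nu (operators B).1 u /\
  vanishes_on_bdry D nu (operators B).2 u.

Definition helmholtz_part k u x : R[i] :=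
  2%:R^-1 * (u x - laplacian u x / (k ^+ 2)%:C).

Definition atkinson_coefficients k (f : nat -> 'rV[R]_3 -> R[i]) u : Prop :=
  forall N, (0 < N)%N -> exists2 g : 'rV[R]_3 -> R[i],
    bigO_at infty_nbhs g (fun x => enorm x ^- N) &
    \forall x \near infty_nbhs,
      u x = cexpi (k * enorm x) / (enorm x)%:C *
            (\sum_(1 <= j < N.+1) f j (dir x) / (enorm x ^+ j.-1)%:C + g x).

End Fields.

(* Families s_1, ..., s_n are functions of the index j : nat, of which only the
   values for 1 <= j <= n matter. *)
Section Recovery.
Context {R : realType}.

Definition Vmatrix n (s : nat -> R) : 'M[R]_n :=
  \matrix_(i < n, j < n) s i.+1 ^- j.

Definition phaseless_data n (s : nat -> R) (u : 'rV[R]_3 -> R[i])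
    (xh : 'rV[R]_3) : 'cV[R]_n :=
  \col_(i < n) (s i.+1 * (normc (u (s i.+1 *: xh)) ^+ 2 - 1)).

Definition Fvec n s u xh : 'cV[R]_n :=
  invmx (Vmatrix n s) *m phaseless_data n s u xh.

(* the j-th entry, counted from 1 *)
Definition entry n (F : 'cV[R]_n) (j : nat) : R :=
  if insub j.-1 is Some i then F i 0 else 0.

Definition Wcoef n (F : 'cV[R]_n) (g : nat -> R[i]) (j : nat) : R[i] :=
  (entry F j)%:C - \sum_(1 <= l < j) g l * (g (j - l)%N)^*.

Definition phase_matrix (k mu s s' : R) : 'M[R[i]]_2 :=
  \matrix_(a < 2, b < 2)
    cexpi ((if a == 0 then s else s') * k * (if b == 0 then 1 - mu else mu - 1)).

Definition col2 (z w : R[i]) : 'cV[R[i]]_2 :=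
  \col_(a < 2) (if a == 0 then z else w).

(* [recovered_upto J] carries the values of the recursion at j = 1, ..., J.
   Only the first component of the solution of each 2 x 2 system is kept: by
   [recoveredE] below, the second one is its conjugate. *)
Fixpoint recovered_upto n (k mu s s' : R) (F F' : 'cV[R]_n) (J : nat) :
    nat -> R[i] :=
  if J is J'.+1 then
    let g := recovered_upto k mu s s' F F' J' in
    fun j => if j == J then
        (invmx (phase_matrix k mu s s') *m col2 (Wcoef F g j) (Wcoef F' g j)) 0 0
      else g j
  else fun=> 0.

Definition recovered n k mu s s' (F F' : 'cV[R]_n) (j : nat) : R[i] :=
  recovered_upto k mu s s' F F' j j.

Section RecoveryTheory.
Context (n : nat) (k mu s tau : R) (F F' : 'cV[R]_n).
Context (tau_generic : sin (tau * k * (1 - mu)) != 0).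

Let M := phase_matrix k mu s (s + tau).
Let g := recovered k mu s (s + tau) F F'.

Lemma recovered_uptoE J j : (j <= J)%N ->
  recovered_upto k mu s (s + tau) F F' J j = g j.
Proof.
elim: J => [|J IH]; first by rewrite leqn0 => /eqP ->.
rewrite leq_eqVlt => /orP[/eqP -> //|jJ].
by rewrite /= ltn_eqF // IH.
Qed.

Lemma eq_Wcoef (G : 'cV[R]_n) (g1 g2 : nat -> R[i]) j :
  (forall l, (l < j)%N -> g1 l = g2 l) -> Wcoef G g1 j = Wcoef G g2 j.
Proof.
move=> g12; congr (_ - _); apply: eq_big_nat => l /andP[l1 lj].
by rewrite !g12 // ltn_subrL l1 (leq_trans _ lj).
Qed.

Lemma Wcoef_real (G : 'cV[R]_n) j : (Wcoef G g j)^* = Wcoef G g j.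
Proof.
rewrite /Wcoef (rmorphB (@conjc R)) (rmorph_sum (@conjc R)) /=; congr (_ - _).
  exact: conjc_real.
rewrite big_nat_rev /=; apply: eq_big_nat => l /andP[l1 lj].
rewrite add1n subSS (rmorphM (@conjc R)) /= conjcK mulrC; congr (_ * (g _)^*).
by rewrite subKn // ltnW.
Qed.

Lemma cexpiD (a b : R) : cexpi (a + b) = cexpi a * cexpi b.
Proof.
by rewrite /cexpi cosD sinD; apply/eqP; rewrite eq_complex /= eqxx addrC eqxx.
Qed.

Lemma cexpiN (a : R) : cexpi (- a) = (cexpi a)^*.
Proof. by rewrite /cexpi cosN sinN. Qed.

Lemma phase_matrix_conj (a b : 'I_2) : (M a b)^* = M a (rev_ord b).
Proof.
rewrite !mxE -cexpiN; congr cexpi.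
by case: b => -[|[|//]] /= lt_b; ring.
Qed.

Lemma phase_matrix_unit : M \in unitmx.
Proof.
rewrite unitmxE unitfE (expand_det_row _ 0) !big_ord_recl big_ord0 /cofactor.
rewrite !det_mx11 !mxE /= addr0 expr0 expr1 !mul1r mulN1r mulrN -!cexpiD.
have -> : s * k * (1 - mu) + (s + tau) * k * (mu - 1) =
  - (tau * k * (1 - mu)) by ring.
have -> : s * k * (mu - 1) + (s + tau) * k * (1 - mu) =
  tau * k * (1 - mu) by ring.
rewrite /cexpi cosN sinN eq_complex /=.
rewrite subrr eqxx /= -opprD oppr_eq0 -mulr2n mulrn_eq0 /=; exact: tau_generic.
Qed.

Lemma recoveredE j : (0 < j)%N ->
  col2 (g j) (g j)^* = invmx M *m col2 (Wcoef F g j) (Wcoef F' g j).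
Proof.
move=> j_gt0; set w := col2 (Wcoef F g j) _; set y := invmx M *m w.
have yE : g j = y 0 0.
  rewrite /g /recovered -(prednK j_gt0) /= eqxx prednK //.
  rewrite (@eq_Wcoef F _ g) ?(@eq_Wcoef F' _ g) // => l lj.
    by rewrite recovered_uptoE // -ltnS prednK.
  by rewrite recovered_uptoE // -ltnS prednK.
pose z : 'cV[R[i]]_2 := \col_a (y (rev_ord a) 0)^*.
have My : M *m y = w by rewrite mulKVmx // phase_matrix_unit.
have Mz : M *m z = w.
  apply/matrixP => a b; rewrite ord1.
  have -> : w a 0 = (w a 0)^*.
    by rewrite !mxE; case: ifP => _; rewrite Wcoef_real.
  rewrite -My [in RHS]mxE [LHS]mxE (rmorph_sum (@conjc R)).
  rewrite (reindex_inj rev_ord_inj) /=.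
  apply: eq_bigr => i _.
  rewrite (rmorphM (@conjc R)) /= phase_matrix_conj; congr (_ * _).
  by rewrite !mxE rev_ordK.
have yz : y = z by rewrite /y -Mz mulKmx // phase_matrix_unit.
apply/matrixP => a b; rewrite ord1 [LHS]mxE yE; case: ifP => a0.
  by rewrite (eqP a0).
rewrite [y in RHS]yz [RHS]mxE; congr (conjc (y _ _)); apply/val_inj.
by case: a a0 => -[|[|//]].
Qed.

End RecoveryTheory.

End Recovery.

(* Main.v *)
Require Import Defs.
From mathcomp Require Import all_boot all_order all_algebra.
From mathcomp Require Import all_classical all_reals all_analysis.
From mathcomp Require Import complex.
From mathcomp Require Import ring lra.

Set Implicit Arguments.
Unset Strict Implicit.
Unset Printing Implicit Defensive.

Import Order.TTheory GRing.Theory Num.Theory.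
Import numFieldNormedType.Exports.

Local Open Scope classical_set_scope.
Local Open Scope ring_scope.
Local Open Scope complex_scope.
(* The name [basis] is otherwise taken by the bases of a topology. *)
Local Notation basis := Defs.basis.

(** The data [s * (|u (s xh)|^2 - 1)] are a quadratic expression in the
    scattered field. If [us] is replaced by its Atkinson expansion
    [exp (i k s) / s * (f_1 + f_2 / s + ...)], they become, with the factor
    [e = exp (i k s (1 - xh . d))], a power series in [1 / s] whose coefficients
    are [e f_j + conj (e f_j) + \sum_(1 <= l < j) f_l conj (f_(j - l))], up to
    [O (s ^- n)] ([phaseless_expansion]). The nodes [t_1, ..., t_n] are chosen
    such that [e] is the same at all of them, so the coefficients solve a
    Vandermonde system up to [O (t ^- n)]. With columns scaled by powers of [t],
    the nodes [t / t_i] of this system converge to the distinct numbers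
    [1 / sigma_i], hence its inverse stays bounded and the [j]-th coefficient is
    found up to [O (t ^- (n + 1 - j))] ([vandermonde_recovery]). The two phases
    [e] at [t_1] and at [t_1 + tau] give two real-linear equations for [f_j] with
    constant determinant, nonzero by the choice of [tau]; an induction on [j]
    controls the quadratic terms ([recursion_decays]).

    The expansion is only known for [u_H], so it has to be shown that
    [u_M = us - u_H] is negligible ([scattered_field_asymptotics]). On the one
    hand, integrating the radiation condition along rays shows that
    [exp (- i k r) us], and hence [us], grows at most linearly, uniformly in the
    direction ([radiating_growth]); [u_H] is bounded by its expansion. So [u_M]
    grows at most linearly. On the other hand, the real and imaginary parts of
    [u_M] solve [lap w = k ^+ 2 * w] outside the obstacle, because the plane wave
    itself satisfies the biharmonic wave equation. For large [|x|] the functions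
    [A |x| ^- (2 m) + eps |x| ^+ 2] are supersolutions of this equation and
    dominate [w] on the boundary of large annuli; by the maximum principle they
    dominate it inside, and [eps -> 0] gives a decay faster than any power of
    [|x|] ([decay_of_subsolution]). *)

(** * Calculus along lines *)

Section LineCalculus.
Context {R : realType} {V : normedModType R}.
Implicit Types (f : V -> R) (x v : V) (h : R).

Lemma derive_line f x v h :
  'D_v f (h *: v + x) = 'D_1 (fun s : R => f (s *: v + x)) h.
Proof.
rewrite /derive; set g1 := fun t => t^-1 *: _; set g2 := fun t => t^-1 *: _.
suff -> : g1 = g2 by [].
by apply/funext => t; rewrite /g1 /g2 /= [t *: 1]mulr1 scalerDl addrA.
Qed.

Lemma derivable_line f x v h :
  derivable f (h *: v + x) v <-> derivable (fun s : R => f (s *: v + x)) h 1.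
Proof.
rewrite /derivable; set g1 := fun t => t^-1 *: _; set g2 := fun t => t^-1 *: _.
suff -> : g1 = g2 by [].
by apply/funext => t; rewrite /g1 /g2 /= [t *: 1]mulr1 scalerDl addrA.
Qed.

Lemma is_derive_line f x v (df : R) :
  is_derive (0 : R) 1 (fun s : R => f (s *: v + x)) df -> is_derive x v f df.
Proof.
move=> [dl <-]; have := derivable_line f x v 0; have := derive_line f x v 0.
by rewrite !scale0r !add0r => <- /iffRL/(_ dl) fx; exact: DeriveDef.
Qed.

(** The mean value inequality for [g s - L * s], on either side of 0. *)
Lemma mean_value_linear (g : R -> R) (L e b : R) :
  (forall s, `|s| <= `|b| -> derivable g s 1 /\ `|'D_1 g s - L| <= e) ->
  `|g b - g 0 - L * b| <= e * `|b|.
Proof.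
move=> H.
have dg (s : R) : `|s| <= `|b| -> is_derive s 1 g ('D_1 g s).
  by move=> /H[/derivableP].
have cg (s : R) : `|s| <= `|b| -> {for s, continuous g}.
  by move=> /H[/derivable1_diffP/differentiable_continuous].
have [b0|b0|<-] := ltgtP 0 b; last by rewrite mulr0 subr0 subrr normr0 mulr0.
- have nb (s : R) : s \in `[0, b] -> `|s| <= `|b|.
    by rewrite in_itv /= => /andP[s0 sb]; rewrite !ger0_norm // ltW.
  have dg' (s : R) : s \in `]0, b[ -> is_derive s 1 g ('D_1 g s).
    by move=> /subset_itv_oo_cc/nb/dg.
  have [|c cb ->] := MVT b0 dg'.
    by apply: continuous_in_subspaceT => s; rewrite inE => /nb/cg.
  rewrite subr0 -mulrBl normrM ler_wpM2r //.
  by apply: (H c _).2; apply: nb; apply: subset_itv_oo_cc.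
have nb (s : R) : s \in `[b, 0] -> `|s| <= `|b|.
  by rewrite in_itv /= => /andP[sb s0]; rewrite !ler0_norm ?lerN2 // ltW.
have dg' (s : R) : s \in `]b, 0[ -> is_derive s 1 g ('D_1 g s).
  by move=> /subset_itv_oo_cc/nb/dg.
have [|c cb gE] := MVT b0 dg'.
  by apply: continuous_in_subspaceT => s; rewrite inE => /nb/cg.
have -> : g b - g 0 - L * b = ('D_1 g c - L) * b.
  by rewrite -[g b - g 0]opprB gE; ring.
rewrite normrM ler_wpM2r //.
by apply: (H c _).2; apply: nb; apply: subset_itv_oo_cc.
Qed.

Lemma second_derivative_at_max (g : R -> R) :
  (\forall s \near 0, derivable g s 1) -> derivable ('D_1 g) 0 1 ->
  (\forall s \near 0, g s <= g 0) -> 'D_1 ('D_1 g) 0 <= 0.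
Proof.
move=> dg ddg gmax; rewrite leNgt; apply/negP => L_gt0.
(* Otherwise ['D_1 g], which vanishes at 0, is positive just after 0, where
   [g] would then exceed [g 0]. *)
have /nbhs_ballP[r /= r0 rP] : \forall s \near (0:R),
  derivable g s 1 /\ g s <= g 0 by near=> s; split; near: s.
have inr (s : R) : s \in `]-r, r[ -> derivable g s 1 /\ g s <= g 0.
  rewrite in_itv /= => /andP[s1 s2]; apply: rP; rewrite /ball /= sub0r normrN.
  by rewrite ltr_norml s1.
have g'0 : 'D_1 g 0 = 0.
  apply: derive_val; apply: (@derive1_at_max _ _ (-r) r).
  - by rewrite ge0_cp // ltW.
  - by move=> t /inr[].
  - by rewrite in_itv /= oppr_lt0 r0.
  - by move=> t /inr[].
have /cvgrPdist_lt/(_ _ L_gt0) :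
   (fun h : R => h^-1 *: ('D_1 g (h *: 1 + 0) - 'D_1 g 0)) @ 0^' --> 'D_1 ('D_1 g) 0 by exact: ddg.
move=> /nbhs_ballP[e /= e0 eP].
pose b := Num.min r e / 2.
have b0 : 0 < b by rewrite divr_gt0 // lt_min r0.
have br : b < r.
  rewrite ltr_pdivrMr //.
  by apply: (@le_lt_trans _ _ r); [rewrite ge_min lexx | lra].
have be : b < e.
  rewrite ltr_pdivrMr //.
  by apply: (@le_lt_trans _ _ e); [rewrite ge_min lexx orbT | lra].
have inb (s : R) : s \in `[0, b] -> s \in `]-r, r[.
  by rewrite !in_itv /= => /andP[s0 sb]; apply/andP; split; lra.
have dg' (s : R) : s \in `]0, b[ -> is_derive s 1 g ('D_1 g s).
  by move=> /subset_itv_oo_cc/inb/inr[/derivableP].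
have [|c cb gE] := MVT b0 dg'.
  apply: continuous_in_subspaceT => s; rewrite inE => /inb/inr[+ _].
  by move=> /derivable1_diffP/differentiable_continuous.
have : g b <= g 0.
  by apply: (inr b (inb b _)).2; rewrite in_itv /= lexx (ltW b0).
rewrite -subr_le0 gE subr0 pmulr_lle0 //.
move: cb; rewrite in_itv /= => /andP[c0 cb].
have := eP c; rewrite /ball /= sub0r normrN gtr0_norm //.
move=> /(_ (lt_trans cb be) (lt0r_neq0 c0)).
rewrite [c *: 1]mulr1 addr0 g'0 subr0 -[_ *: _]/(_ * _) => /ltr_normlP[_ lt_L].
have : 0 < c^-1 * 'D_1 g c by move: lt_L; set q := c^-1 * _; lra.
by rewrite pmulr_rgt0 ?invr_gt0 // ltNge => /negbTE ->.
Unshelve. all: by end_near. Qed.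

End LineCalculus.

(** * Continuous partial derivatives and the Laplacian *)

Section ContinuousPartials.
Context {R : realType} {n : nat}.
Implicit Types (g : 'rV[R]_n.+1 -> R) (x v : 'rV[R]_n.+1).

(** A function with continuous partial derivatives is derivable in every
    direction, by going from [x] to [x + h v] parallel to the axes. *)
Lemma is_derive_partials g x v :
  (forall i : 'I_n.+1, \forall y \near x, derivable g y (basis i)) ->
  (forall i : 'I_n.+1, {for x, continuous ('D_(basis i) g)}) ->
  is_derive x v g (\sum_i v 0 i * 'D_(basis i) g x).
Proof.
move=> dg cg; set L := \sum_i _.
suff gL : h^-1 *: ((g \o shift x) (h *: v) - g x) @[h --> 0^'] --> L.
  by apply: DeriveDef; [exact: cvgP gL|exact: cvg_lim gL].
(* [x + h p_0], ..., [x + h p_(n.+1)] are the corners of the path. *)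
pose p m : 'rV[R]_n.+1 := \sum_(i < n.+1 | (i < m)%N) v 0 i *: basis i.
have p0 : p 0%N = 0 by rewrite /p big_pred0.
have pn : p n.+1 = v.
  rewrite /p [RHS]row_sum_delta; apply: eq_big => // i; exact: ltn_ord.
have pS (i : 'I_n.+1) : p i.+1 = v 0 i *: basis i + p i.
  rewrite /p (bigD1 i) //=; congr (_ + _); apply: eq_bigl => j.
  by rewrite ltnS ltn_neqAle andbC.
(* The path stays within distance [`|h| * C] of [x], and [S] bounds its length
   in units of [`|h|]. *)
pose C := 1 + \sum_i (`|v 0 i| * `|basis i : 'rV[R]_n.+1| + `|p i|).
have C0 : 0 < C.
  by rewrite ltr_pwDl // sumr_ge0 // => i _; rewrite addr_ge0 // mulr_ge0.
pose S := 1 + \sum_i `|v 0 i|.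
have S0 : 0 < S by rewrite ltr_pwDl // sumr_ge0.
apply/cvgrPdist_le => e e0.
have eS0 : 0 < e / S by rewrite divr_gt0.
have /nbhs_ballP[r /= r0 rP] : \forall y \near x, forall i : 'I_n.+1,
    derivable g y (basis i) /\
    `|'D_(basis i) g y - 'D_(basis i) g x| <= e / S.
  apply: (@filter_forall _ _ (fun (i : 'I_n.+1) y => derivable g y (basis i) /\
    `|'D_(basis i) g y - 'D_(basis i) g x| <= e / S) (nbhs x) _) => i.
  near=> y; split; first by near: y; exact: dg.
  rewrite distrC; near: y.
  by have /cvgrPdist_le/(_ _ eS0) := cg i.
apply/nbhs_ballP; exists (r / C) => /=; first by rewrite divr_gt0.
move=> h; rewrite /ball /= sub0r normrN => hr h0.
have step (i : 'I_n.+1) :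
    `|g (h *: p i.+1 + x) - g (h *: p i + x) - h * (v 0 i * 'D_(basis i) g x)|
    <= `|h| * (e / S * `|v 0 i|).
  have -> : `|h| * (e / S * `|v 0 i|) = e / S * `|h * v 0 i|.
    by rewrite normrM; ring.
  have -> : h *: p i.+1 + x = (h * v 0 i) *: basis i + (h *: p i + x).
    by rewrite pS scalerDr scalerA addrA.
  have -> : g (h *: p i + x) = g ((0 : R) *: basis i + (h *: p i + x)).
    by rewrite scale0r add0r.
  rewrite mulrA [h * _ * _]mulrC.
  apply: (@mean_value_linear R
    (fun s => g (s *: basis i + (h *: p i + x)))) => s sh.
  rewrite -derivable_line -derive_line.
  apply: (rP (s *: basis i + (h *: p i + x)) _ i).
  rewrite -ball_normE /ball_ /= addrA opprD addrCA subrr addr0 normrN.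
  apply: (@le_lt_trans _ _ (`|h| * C)); last by rewrite -ltr_pdivlMr.
  rewrite (le_trans (ler_normD _ _)) // !normrZ.
  apply: (@le_trans _ _ (`|h| * (`|v 0 i| * `|basis i : 'rV[R]_n.+1| + `|p i|))).
    by rewrite mulrDr lerD2r mulrA -normrM ler_wpM2r.
  rewrite ler_wpM2l // /C (bigD1 i) //= addrCA lerDl.
  by rewrite addr_ge0 //; apply: sumr_ge0 => j _; rewrite addr_ge0 // mulr_ge0.
have -> : L - h^-1 *: ((g \o shift x) (h *: v) - g x) =
    - (h^-1 * (\sum_(i < n.+1) (g (h *: p i.+1 + x) - g (h *: p i + x) -
        h * (v 0 i * 'D_(basis i) g x)))).
  rewrite sumrB -mulr_sumr -/L.
  rewrite -(big_mkord xpredT (fun i => g (h *: p i.+1 + x) - g (h *: p i + x))).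
  rewrite telescope_sumr // pn p0 scaler0 add0r /= mulrBr mulKf //.
  by rewrite opprB.
rewrite normrN normrM normfV ler_pdivrMl ?normr_gt0 //.
apply: (@le_trans _ _ (\sum_(i < n.+1) `|h| * (e / S * `|v 0 i|))).
  by rewrite (le_trans (ler_norm_sum _ _ _)) // ler_sum.
rewrite -!mulr_sumr ler_wpM2l // mulrAC ler_pdivrMr //.
by apply: ler_wpM2l; [exact: ltW|rewrite /S lerDr].
Unshelve. all: by end_near. Qed.

End ContinuousPartials.

Section Laplacian.
Context {R : realType} {n : nat}.
Implicit Types (f g : 'rV[R]_n.+1 -> R) (U : set 'rV[R]_n.+1) (x : 'rV[R]_n.+1).

(** The Laplacian of a real-valued function. Like the partial derivatives, it
    has a default value where these do not exist. *)
Definition lap g x : R := \sum_i 'D_(basis i) ('D_(basis i) g) x.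

(** The pure second partial derivatives exist at every point of [U]. *)
Definition twice_derivable U g : Prop := forall i x, U x ->
  derivable g x (basis i) /\ derivable ('D_(basis i) g) x (basis i).

Lemma derive_eq_on U f g v x : open U -> (forall y, U y -> f y = g y) ->
  U x -> 'D_v f x = 'D_v g x.
Proof.
move=> oU fg Ux; apply: near_eq_derive; have : nbhs x U by exact: open_nbhs_nbhs.
by apply: filterS => y; exact: fg.
Qed.

Lemma derivable_eq_on U f g v x : open U -> (forall y, U y -> f y = g y) ->
  U x -> derivable f x v -> derivable g x v.
Proof.
move=> oU fg Ux; apply: near_eq_derivable.
have : nbhs x U by exact: open_nbhs_nbhs.
by apply: filterS => y; exact: fg.
Qed.

Lemma lap_eq_on U f g x : open U -> (forall y, U y -> f y = g y) ->
  U x -> lap f x = lap g x.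
Proof.
move=> oU fg Ux; apply: eq_bigr => i _; apply: (derive_eq_on _ oU) => // y Uy.
exact: (derive_eq_on _ oU).
Qed.

Lemma twice_derivableD U f g : open U -> twice_derivable U f ->
  twice_derivable U g -> twice_derivable U (f + g).
Proof.
move=> oU df dg i x Ux; have [f1 f2] := df i x Ux; have [g1 g2] := dg i x Ux.
split; first exact: derivableD.
refine (derivable_eq_on oU _ Ux (derivableD f2 g2)) => y Uy.
exact/esym/(deriveD (df i y Uy).1 (dg i y Uy).1).
Qed.

Lemma twice_derivableZ U f a : open U -> twice_derivable U f ->
  twice_derivable U (a *: f).
Proof.
move=> oU df i x Ux; have [f1 f2] := df i x Ux.
split; first exact: derivableZ.
refine (derivable_eq_on oU _ Ux (derivableZ (k := a) f2)) => y Uy.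
exact/esym/(deriveZ a (df i y Uy).1).
Qed.

Lemma lapD U f g x : open U -> twice_derivable U f -> twice_derivable U g ->
  U x -> lap (f + g) x = lap f x + lap g x.
Proof.
move=> oU df dg Ux; rewrite -big_split /=; apply: eq_bigr => i _.
rewrite -(deriveD (df i x Ux).2 (dg i x Ux).2).
refine (derive_eq_on _ oU _ Ux) => y Uy.
exact: (deriveD (df i y Uy).1 (dg i y Uy).1).
Qed.

Lemma lapZ U f a x : open U -> twice_derivable U f ->
  U x -> lap (a *: f) x = a * lap f x.
Proof.
move=> oU df Ux; rewrite mulr_sumr; apply: eq_bigr => i _.
rewrite -[a * _](deriveZ a (df i x Ux).2).
refine (derive_eq_on _ oU _ Ux) => y Uy.
exact: (deriveZ a (df i y Uy).1).
Qed.

Lemma class_C_twice_derivable U g : class_C 2 U g -> twice_derivable U g.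
Proof.
move=> Cg i x Ux; split; first exact: ((Cg [::] isT).2 isT i x Ux).
exact: ((Cg [:: i] isT).2 isT i x Ux).
Qed.

Lemma class_C_continuous m U g x : class_C m U g -> U x ->
  {for x, continuous g}.
Proof. by move=> Cg Ux; apply: (Cg [::] (leq0n _)).1. Qed.

Lemma lapE g : lap g = \sum_i iter_partial [:: i; i] g.
Proof. by apply/funext => x; rewrite fct_sumE. Qed.

Lemma class_C4_lap_continuous U g x : class_C 4 U g -> U x ->
  {for x, continuous (lap g)}.
Proof.
move=> Cg Ux; rewrite /lap.
apply: (@cvg_big R _ +%R 0 xpredT _ _ (nbhs x)) => [|i _].
  exact: add_continuous.
exact: (Cg [:: i; i] isT).1.
Qed.

Lemma class_C4_lap_twice_derivable U g : open U -> class_C 4 U g ->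
  twice_derivable U (lap g).
Proof.
move=> oU Cg; rewrite lapE.
apply: (big_ind (twice_derivable U)) => [|f1 f2|i _ j x Ux].
- move=> i x _; split; first exact: derivable_cst.
  rewrite (_ : 'D_(basis i) _ = 0); first exact: derivable_cst.
  by apply/funext => y; exact: derive_cst.
- exact: twice_derivableD.
- split; first exact: ((Cg [:: i; i] isT).2 isT j x Ux).
  exact: ((Cg [:: j; i; i] isT).2 isT j x Ux).
Qed.

Lemma lap_le0_at_max g x :
  (\forall y \near x, forall i, derivable g y (basis i)) ->
  (forall i, derivable ('D_(basis i) g) x (basis i)) ->
  (\forall y \near x, g y <= g x) -> lap g x <= 0.
Proof.
move=> dg ddg gmax; apply: sumr_le0 => i _.
have cl : s *: basis i + x @[s --> (0:R)] --> x.
  have D : differentiable (fun s : R => s *: basis i + x) 0 by [].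
  have E : (0 : R) *: basis i + x = x by rewrite scale0r add0r.
  by rewrite -[X in _ --> X]E; exact: differentiable_continuous D.
rewrite -[x in leLHS]add0r -(scale0r (basis i)) derive_line.
have -> : (fun s : R => 'D_(basis i) g (s *: basis i + x)) =
    'D_1 (fun s : R => g (s *: basis i + x)).
  by apply/funext => s; rewrite derive_line.
apply: second_derivative_at_max.
- apply: (@filterS _ (nbhs (0 : R)) _ _ _ _ (cl _ dg)) => s /(_ i).
  by rewrite /preimage derivable_line.
- have -> : 'D_1 (fun s : R => g (s *: basis i + x)) =
     (fun s : R => 'D_(basis i) g (s *: basis i + x)).
    by apply/funext => s; rewrite derive_line.
  have := derivable_line ('D_(basis i) g) x (basis i) 0.
  by rewrite scale0r add0r => -[+ _]; apply.
- apply: (@filterS _ (nbhs (0 : R)) _ _ _ _ (cl _ gmax)) => s.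
  by rewrite /preimage /= scale0r add0r.
Qed.

End Laplacian.

(** * The Euclidean norm and the maximum principle *)

Section EuclideanNorm.
Context {R : realType} {n : nat}.
Implicit Types (x y v : 'rV[R]_n.+1).

Lemma dotC x y : dot x y = dot y x.
Proof. by apply: eq_bigr => i _; rewrite mulrC. Qed.

Lemma dotDl x y v : dot (x + y) v = dot x v + dot y v.
Proof. by rewrite -big_split; apply: eq_bigr => i _; rewrite mxE mulrDl. Qed.

Lemma dotZl a x y : dot (a *: x) y = a * dot x y.
Proof. by rewrite mulr_sumr; apply: eq_bigr => i _; rewrite mxE mulrA. Qed.

Lemma dotDr x y v : dot v (x + y) = dot v x + dot v y.
Proof. by rewrite !(dotC v) dotDl. Qed.

Lemma dotZr a x y : dot x (a *: y) = a * dot x y.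
Proof. by rewrite !(dotC x) dotZl. Qed.

Lemma dot_basis i x : dot (basis i) x = x 0 i.
Proof.
rewrite /dot (bigD1 i) //= !mxE !eqxx mul1r big1 ?addr0 // => j ji.
by rewrite !mxE (negbTE ji) andbF mul0r.
Qed.

Lemma dot_ge0 x : 0 <= dot x x.
Proof. by apply: sumr_ge0 => i _; rewrite -expr2 sqr_ge0. Qed.

Lemma dot_eq0 x : dot x x = 0 -> x = 0.
Proof.
move=> /eqP; rewrite psumr_eq0 => [/allP x0|i _]; last by rewrite -expr2 sqr_ge0.
apply/rowP => i; rewrite mxE; apply/eqP.
by have := x0 i (mem_index_enum _); rewrite -expr2 sqrf_eq0.
Qed.

Lemma enorm_ge0 x : 0 <= enorm x.
Proof. exact: sqrtr_ge0. Qed.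

Lemma sqr_enorm x : enorm x ^+ 2 = dot x x.
Proof. by rewrite sqr_sqrtr // dot_ge0. Qed.

Lemma enormZ a x : enorm (a *: x) = `|a| * enorm x.
Proof.
by rewrite /enorm dotZl dotZr mulrA -expr2 sqrtrM ?sqr_ge0 // sqrtr_sqr.
Qed.

Lemma coord_le_enorm x i : `|x 0 i| <= enorm x.
Proof.
rewrite -sqrtr_sqr ler_wsqrtr // /dot (bigD1 i) //= expr2 lerDl.
by apply: sumr_ge0 => j _; rewrite -expr2 sqr_ge0.
Qed.

Lemma norm_le_enorm x : `|x| <= enorm x.
Proof.
rewrite [leLHS]/Num.norm /= mx_normrE; apply/bigmax_leP; split=> [|[i j] _ /=].
  exact: enorm_ge0.
by rewrite ord1; exact: coord_le_enorm.
Qed.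

Lemma enorm_le_norm x : enorm x <= n.+1%:R * `|x|.
Proof.
have xi i : `|x 0 i| <= `|x|.
  have /mapP[j Hj ->] : `|x 0 i| \in [seq `|x v.1 v.2| | v : 'I_1 * 'I_n.+1].
    by apply/mapP; exists (0, i) => //=; rewrite mem_enum.
  by rewrite [leRHS]/Num.norm /= mx_normrE; apply/bigmax_geP; right => /=; exists j.
rewrite -[leRHS]ger0_norm ?mulr_ge0 // -sqrtr_sqr ler_wsqrtr // exprMn.
apply: (@le_trans _ _ (\sum_(i < n.+1) `|x| ^+ 2)).
  apply: ler_sum => i _; rewrite -expr2 -real_normK ?num_real //.
  by rewrite lerXn2r ?nnegrE.
rewrite sumr_const card_ord -[_ ^+ 2 *+ _]mulr_natl ler_wpM2r ?sqr_ge0 //.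
by rewrite -natrX ler_nat leq_pmulr.
Qed.

Lemma dot_continuous : continuous (fun x => dot x x).
Proof.
move=> x.
apply: (@cvg_big R _ +%R 0 xpredT _ _ (nbhs x)) => [|i _].
  exact: add_continuous.
by apply: cvgM; exact: coord_continuous.
Qed.

Lemma enorm_continuous : continuous (fun x => enorm x).
Proof.
move=> x; apply: (@continuous_comp _ _ _ (fun x => dot x x) Num.sqrt).
  exact: dot_continuous.
exact: sqrt_continuous.
Qed.

Lemma annulus_compact a b : compact [set x : 'rV[R]_n.+1 | a <= enorm x <= b].
Proof.
apply: bounded_closed_compact.
  exists b; split; first exact: num_real.
  move=> c bc x /= /andP[_ xb].
  by rewrite (le_trans (norm_le_enorm x)) // (le_trans xb) // ltW.
rewrite (_ : mkset _ = (fun x => enorm x) @^-1` `[a, b]).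
  apply: closed_comp; last exact: interval_closed.
  by move=> x _; exact: enorm_continuous.
by apply/seteqP; split => x /=; rewrite in_itv.
Qed.

Lemma bounded_on_annulus (U : set 'rV[R]_n.+1) (g : 'rV[R]_n.+1 -> R) a b :
  (forall x, U x -> {for x, continuous g}) ->
  (forall x, a <= enorm x <= b -> U x) ->
  exists M, 0 <= M /\ forall x, a <= enorm x <= b -> `|g x| <= M.
Proof.
move=> cg aU; set K := [set x : 'rV[R]_n.+1 | a <= enorm x <= b].
have [[x0 Kx0]|K0] := pselect (K !=set0); last first.
  by exists 0; split=> // x Kx; exfalso; apply: K0; exists x.
have [||c _ cmax] := @EVT_max_rV R _ (fun x => `|g x|) K _ (@annulus_compact a b).
- by exists x0.
- apply: continuous_in_subspaceT => x; rewrite inE => /aU/cg gx.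
  by apply: continuous_comp gx _; exact: norm_continuous.
by exists `|g c|; split=> // x Kx; apply: cmax; rewrite inE.
Qed.

(** The factor [n.+1%:R] accounts for boundedness being stated with the sup
    norm. *)
Lemma exterior_infty (D : set 'rV[R]_n.+1) : bounded_set D ->
  exists r, 0 < r /\ forall x, r <= enorm x -> (~` closure D) x.
Proof.
move=> [M [_ MP]]; pose r := n.+1%:R * (Num.max M 0 + 1) + 1.
have M0 : 0 <= Num.max M 0 by rewrite le_max lexx orbT.
exists r; split; first by rewrite ltr_wpDl // mulr_ge0 // addr_ge0.
move=> x rx Dx.
have : closed [set x : 'rV[R]_n.+1 | `|x| <= Num.max M 0 + 1].
  rewrite (_ : mkset _ = (fun x => `|x|) @^-1` [set y | y <= Num.max M 0 + 1]) //.
  by apply: closed_comp; [move=> y _; exact: norm_continuous|exact: closed_le].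
rewrite closure_id => closed_eq; have : `|x| <= Num.max M 0 + 1.
  have : closure [set x : 'rV[R]_n.+1 | `|x| <= Num.max M 0 + 1] x.
    apply: closureS Dx => y Dy; apply: MP => //.
    by rewrite (le_lt_trans (_ : M <= Num.max M 0)) ?le_max ?lexx // ltrDl.
  by rewrite -closed_eq.
apply/negP; rewrite -ltNge.
rewrite -(@ltr_pM2l _ n.+1%:R) // (lt_le_trans _ (enorm_le_norm x)) //.
by rewrite (lt_le_trans _ rx) // ltrDl.
Qed.

End EuclideanNorm.

Section MaximumPrinciple.
Context {R : realType} {n : nat}.
Implicit Types (U : set 'rV[R]_n.+1) (v : 'rV[R]_n.+1 -> R) (x : 'rV[R]_n.+1).

(** At a positive interior maximum the Laplacian would be nonpositive. *)
Lemma maximum_principle U v a b :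
  open U -> (forall x, a <= enorm x <= b -> U x) ->
  (forall x, U x -> {for x, continuous v}) -> twice_derivable U v ->
  (forall x, a < enorm x < b -> 0 < v x -> 0 < lap v x) ->
  (forall x, enorm x = a \/ enorm x = b -> v x <= 0) ->
  forall x, a <= enorm x <= b -> v x <= 0.
Proof.
move=> oU KU cv dv lapv vb x0 Kx0.
set K := [set x : 'rV[R]_n.+1 | a <= enorm x <= b].
have [||c + cmax] := @EVT_max_rV R _ v K _ (@annulus_compact R n a b).
- by exists x0.
- by apply: continuous_in_subspaceT => x; rewrite inE => /KU/cv.
rewrite inE => Kc; have v0c : v x0 <= v c by apply: cmax; rewrite inE.
rewrite leNgt; apply/negP => v0; have vc0 := lt_le_trans v0 v0c.
have /andP[ac cb] := Kc.
have ca : enorm c != a.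
  by apply/eqP => E; have := vb c (or_introl E); rewrite leNgt vc0.
have cb' : enorm c != b.
  by apply/eqP => E; have := vb c (or_intror E); rewrite leNgt vc0.
have ic : a < enorm c < b by rewrite !lt_neqAle ac cb cb' eq_sym ca.
have := lapv c ic vc0; rewrite ltNge => /negP; apply.
have nK : \forall y \near c, a < enorm y < b.
  have : nbhs (enorm c) `]a, b[%classic.
    by apply: open_nbhs_nbhs; split; [exact: interval_open|rewrite /= in_itv].
  move=> /(@enorm_continuous R n c) nc.
  by apply: (@filterS _ (nbhs c) _ _ _ _ nc) => y; rewrite /preimage /= in_itv.
apply: lap_le0_at_max.
- apply: (@filterS _ (nbhs c) _ _ _ _ nK) => y /andP[ay yb] i.
  by apply: (dv i y _).1; apply: KU; rewrite !ltW.
- by move=> i; apply: (dv i c _).2; apply: KU.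
- apply: (@filterS _ (nbhs c) _ _ _ _ nK) => y /andP[ay yb].
  by apply: cmax; rewrite inE /K /= !ltW.
Qed.

End MaximumPrinciple.

(** * A barrier for the modified Helmholtz equation *)

Section Barrier.
Context {R : realType}.
Implicit Types (x : 'rV[R]_3).

(* The squared Euclidean norm is easier to differentiate than the norm. *)
Let q x := dot x x.

Lemma is_derive_coord i j x :
  is_derive x (basis i) (fun y : 'rV[R]_3 => y 0 j) (i == j)%:R.
Proof.
apply: is_derive_line; set d := (i == j)%:R.
have -> : (fun s : R => (s *: basis i + x) 0 j) = (fun s => s * d + x 0 j).
  by apply/funext => s; rewrite !mxE /d eq_sym andTb.
apply: is_derive_eq.
by rewrite /GRing.scale /=; ring.
Qed.

Lemma is_derive_dot i x : is_derive x (basis i) q (2 * x 0 i).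
Proof.
apply: is_derive_line.
have -> : (fun s : R => q (s *: basis i + x)) =
    (fun s => q x + s * (2 * x 0 i) + s ^+ 2).
  apply/funext => s; rewrite /q dotDl !dotDr !dotZl !dotZr (dotC x) !dot_basis.
  rewrite /Defs.basis !mxE !eqxx.
  by rewrite /=; ring.
apply: is_derive_eq.
by rewrite /GRing.scale /=; ring.
Qed.

Lemma is_derive_inv_dot m i x : q x != 0 ->
  is_derive x (basis i) (fun y => (q y)^-1 ^+ m)
    (- 2 * m%:R * (x 0 i * (q x)^-1 ^+ m.+1)).
Proof.
move=> q0; have [dq qE] := is_derive_dot i x.
have dw : is_derive x (basis i) (fun y => (q y)^-1) (- (2 * x 0 i) * (q x)^-1 ^+ 2).
  apply: DeriveDef; first exact: derivableV.
  by rewrite deriveV // qE -exprVn /GRing.scale /=; ring.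
have -> : (fun y => (q y)^-1 ^+ m) = (fun y => (q y)^-1) ^+ m.
  by rewrite exprfctE.
apply: is_derive_eq.
by case: m => [|m]; rewrite /GRing.scale /= ?exprS; ring.
Qed.

Lemma open_dot_neq0 : open [set x | q x != 0].
Proof.
rewrite (_ : [set x | q x != 0] = q @^-1` [set y | y != 0]) //.
by apply: open_comp; [move=> x _; exact: dot_continuous|exact: open_neq].
Qed.

Lemma inv_dot_derivatives m i x : q x != 0 ->
  is_derive x (basis i) ('D_(basis i) (fun y => (q y)^-1 ^+ m))
    (- 2 * m%:R * ((q x)^-1 ^+ m.+1 +
       x 0 i * (- 2 * m.+1%:R * (x 0 i * (q x)^-1 ^+ m.+2)))).
Proof.
move=> q0; have dw := is_derive_inv_dot m.+1 i q0.
have dx := is_derive_coord i i x; rewrite eqxx in dx.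
apply: (@near_eq_is_derive _ _ _
  (fun y : 'rV[R]_3 => (- 2 * m%:R) *: (y 0 i * (q y)^-1 ^+ m.+1))).
  have : nbhs x [set y | q y != 0].
    by apply: open_nbhs_nbhs; split => //; exact: open_dot_neq0.
  apply: filterS => y qy.
  rewrite [RHS](@derive_val _ _ _ _ _ _ _ (is_derive_inv_dot m i qy)).
  by [].
apply: is_derive_eq.
by rewrite /GRing.scale /=; ring.
Qed.

Lemma twice_derivable_inv_dot m :
  twice_derivable [set x | q x != 0] (fun y => (q y)^-1 ^+ m).
Proof.
move=> i x q0; split; first by case: (is_derive_inv_dot m i q0).
by case: (inv_dot_derivatives m i q0).
Qed.

Lemma lap_inv_dot m x : q x != 0 ->
  lap (fun y => (q y)^-1 ^+ m) x = m%:R * (4 * m%:R - 2) * (q x)^-1 ^+ m.+1.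
Proof.
move=> q0.
rewrite /lap; under eq_bigr do
  rewrite (@derive_val _ _ _ _ _ _ _ (inv_dot_derivatives m _ q0)).
have -> : (q x)^-1 ^+ m.+1 = q x * (q x)^-1 ^+ m.+2.
  by rewrite [in RHS]exprS mulrA divff // mul1r.
set W := (q x)^-1 ^+ m.+2.
under eq_bigr => i _.
  have -> : x 0 i * (- 2 * m.+1%:R * (x 0 i * W)) =
      (- 2 * m.+1%:R * W) * (x 0 i * x 0 i).
    by ring.
  over.
rewrite -mulr_sumr big_split /= -[X in _ + X]mulr_sumr -/(dot x x) -/(q x).
rewrite sumr_const card_ord -[_ *+ 3]mulr_natl.
by rewrite -[m.+1%:R]natr1; ring.
Qed.

Lemma derive_dot_derivatives i x :
  is_derive x (basis i) ('D_(basis i) q) 2.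
Proof.
have dx := is_derive_coord i i x; rewrite eqxx in dx.
have -> : 'D_(basis i) q = (fun y : 'rV[R]_3 => 2 *: (y 0 i)).
  by apply/funext => y; rewrite (@derive_val _ _ _ _ _ _ _ (is_derive_dot i y)).
by apply: is_derive_eq; rewrite /GRing.scale /= mulr1.
Qed.

Lemma twice_derivable_dot U : twice_derivable U q.
Proof.
move=> i x _; split; first by case: (is_derive_dot i x).
by case: (derive_dot_derivatives i x).
Qed.

Lemma lap_dot x : lap q x = 6.
Proof.
rewrite /lap; under eq_bigr do
  rewrite (@derive_val _ _ _ _ _ _ _ (derive_dot_derivatives _ _)).
by rewrite sumr_const card_ord -mulr_natr; ring.
Qed.

(** A subsolution of [lap w = k ^+ 2 * w] near infinity that grows at most
    linearly is bounded above by any negative power of the distance: there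
    [A * W + eps * q], with [W = q ^- m], is a supersolution, which is at least
    [w] on the boundary of large annuli. *)
Lemma decay_of_subsolution (k : R) (U : set 'rV[R]_3) (w : 'rV[R]_3 -> R)
    (r0 B : R) m :
  0 < k -> 0 < r0 -> open U -> (forall x, r0 <= enorm x -> U x) ->
  (forall x, U x -> {for x, continuous w}) -> twice_derivable U w ->
  (forall x, U x -> k ^+ 2 * w x <= lap w x) ->
  (forall x, r0 <= enorm x -> w x <= B * (1 + enorm x)) ->
  exists A r1, forall x, r1 <= enorm x -> w x <= A * (enorm x)^-1 ^+ (2 * m).
Proof.
move=> k0 r00 oU rU cw dw lapw wB.
(* [c] bounds both [m * (4 * m - 2)] and 6, the factors in [lap W] and [lap q];
   since [1 <= c], [c / k <= r] implies [c <= k ^+ 2 * r ^+ 2]. *)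
pose c : R := 1 + 4 * m%:R ^+ 2 + 6.
have c1 : 1 <= c by have := sqr_ge0 (m%:R : R); rewrite /c; lra.
pose r1 := r0 + c / k.
have r1r0 : r0 <= r1 by rewrite /r1 lerDl divr_ge0 ?ltW //; lra.
have r10 : 0 < r1 by exact: lt_le_trans r1r0.
have [M [M0 MP]] : exists M, 0 <= M /\ forall x, r1 <= enorm x <= r1 -> `|w x| <= M.
  apply: (bounded_on_annulus cw) => x /andP[r1x _]; apply: rU; exact: le_trans r1x.
pose A := M * (r1 ^+ 2) ^+ m.
have A0 : 0 <= A by rewrite mulr_ge0 // !exprn_ge0 // ltW.
have kc x : r1 <= enorm x -> c <= k ^+ 2 * q x.
  move=> r1x; rewrite /q -sqr_enorm -exprMn.
  have : c <= k * enorm x.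
    rewrite -ler_pdivrMl // mulrC (le_trans _ r1x) // /r1 lerDr; lra.
  by move=> cx; rewrite (le_trans cx) // expr2 ler_peMl //; lra.
have q_gt0 x : r1 <= enorm x -> 0 < q x.
  by move=> r1x; rewrite /q -sqr_enorm exprn_gt0 // (lt_le_trans r10).
pose U' := U `&` [set x | q x != 0].
have oU' : open U' by apply: openI => //; exact: open_dot_neq0.
have rU' x : r1 <= enorm x -> U' x.
  move=> r1x; split; first by apply: rU; exact: le_trans r1x.
  by apply: lt0r_neq0; exact: q_gt0.
pose W x := (q x)^-1 ^+ m.
have dW : twice_derivable U' W by move=> i x [_ q0]; exact: twice_derivable_inv_dot.
have dw' : twice_derivable U' w by move=> i x [Ux _]; exact: dw.
have cW x : U' x -> {for x, continuous W}.
  move=> [_ q0].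
  apply: (@continuous_comp _ _ _ (fun y => (q y)^-1) (fun y : R => y ^+ m)).
    have qx : q y @[y --> x] --> q x := @dot_continuous R 2 x.
    exact: (cvgV q0 qx).
  exact: exprn_continuous.
exists A, r1 => x r1x; rewrite exprM [_^-1 ^+ 2]exprVn sqr_enorm -/(W x).
apply/ler_addgt0Pr => e e0.
pose eps := e / q x.
have eps0 : 0 < eps by rewrite divr_gt0 // q_gt0.
(* At radius [rho] the term [eps * q] exceeds the linear growth of [w]. *)
pose rho := enorm x + 1 + 2 * `|B| / eps.
have z0 : 0 <= 2 * `|B| / eps.
  by apply: divr_ge0; [exact: mulr_ge0|exact: ltW].
have ex0 := enorm_ge0 x.
have rho1 : 1 <= rho by rewrite /rho; lra.
have rhox : enorm x <= rho by rewrite /rho; lra.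
pose v := w + (- A) *: W + (- eps) *: q.
have vE y : v y = w y - A * W y - eps * q y.
  by rewrite /v !fctE /GRing.scale /=; ring.
have dAW := twice_derivableZ (- A) oU' dW.
have deq := twice_derivableZ (- eps) oU' (@twice_derivable_dot U').
suff : v x <= 0.
  rewrite vE subr_le0 /eps divfK ?gt_eqF ?q_gt0 // lerBlDr addrC.
  by [].
apply: (@maximum_principle R 2 U' v r1 rho oU').
- by move=> y /andP[/rU'].
- move=> y Uy.
  have wy : w z @[z --> y] --> w y by apply: cw; case: Uy.
  have Wy : W z @[z --> y] --> W y := cW y Uy.
  have qy : q z @[z --> y] --> q y := @dot_continuous R 2 y.
  exact: (cvgD (cvgD wy (cvgZl_tmp (k := - A) Wy)) (cvgZl_tmp (k := - eps) qy)).
- exact: (twice_derivableD oU' (twice_derivableD oU' dw' dAW) deq).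
- move=> y /andP[r1y _] v_gt0; have {}r1y := ltW r1y.
  have Uy := rU' y r1y.
  rewrite (lapD oU' (twice_derivableD oU' dw' dAW) deq Uy).
  rewrite (lapD oU' dw' dAW Uy) (lapZ _ oU' dW Uy).
  rewrite (lapZ _ oU' (@twice_derivable_dot U') Uy).
  have lw : k ^+ 2 * w y <= lap w y by apply: lapw; case: Uy.
  rewrite lap_dot lap_inv_dot ?gt_eqF ?q_gt0 //.
  have Wy0 : 0 <= W y by rewrite exprn_ge0 // invr_ge0 ltW // q_gt0.
  have qy0 := q_gt0 y r1y; have kcy := kc y r1y.
  have Wle : m%:R * (4 * m%:R - 2) * (q y)^-1 ^+ m.+1 <= k ^+ 2 * W y.
    rewrite exprS mulrA ler_wpM2r // ler_pdivrMr // (le_trans _ kcy) // /c.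
    have : 0 <= (m%:R : R) by [].
    by move=> ?; rewrite expr2; lra.
  have epsq : eps * 6 <= k ^+ 2 * (eps * q y).
    rewrite mulrCA ler_wpM2l ?(ltW eps0) // (le_trans _ kcy) // /c.
    by have := sqr_ge0 (m%:R : R); lra.
  have AW := ler_wpM2l A0 Wle.
  have kv : 0 < k ^+ 2 * v y by rewrite mulr_gt0 // exprn_gt0.
  rewrite vE in kv; move: kv AW epsq lw; set T := _ ^-1 ^+ m.+1.
  nra.
- move=> y yb; rewrite vE.
  have r1y : r1 <= enorm y by case: yb => ->; rewrite // (le_trans r1x).
  have Wy0 : 0 <= W y by rewrite exprn_ge0 // invr_ge0 ltW // q_gt0.
  have qy0 := q_gt0 y r1y.
  case: yb => yE.
    have -> : A * W y = M.
      rewrite /A /W /q -sqr_enorm yE -mulrA -exprMn divff ?expr1n ?mulr1 //.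
      by rewrite gt_eqF // exprn_gt0.
    have : w y <= M by rewrite (le_trans (ler_norm _)) // MP // yE lexx.
    by have := mulr_gt0 eps0 qy0; lra.
  have : w y <= eps * q y.
    rewrite (le_trans (wB y (le_trans r1r0 r1y))) // /q -sqr_enorm yE.
    apply: (@le_trans _ _ (`|B| * (2 * rho))).
      apply: (@le_trans _ _ (`|B| * (1 + rho))).
        by apply: ler_wpM2r; [lra|exact: ler_norm].
      by apply: ler_wpM2l => //; lra.
    rewrite mulrA expr2 mulrA ler_wpM2r //; first lra.
    rewrite mulrC -ler_pdivrMl // mulrC /rho; lra.
  by have := mulr_ge0 A0 Wy0; lra.
- by rewrite r1x.
Qed.

End Barrier.

(** * Plane waves and the modified Helmholtz part *)

Section ComplexModulus.
Context {R : realType}.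
Implicit Types (z w : R[i]).

Lemma normc_ge0 z : 0 <= normc z.
Proof. by case: z => a b; exact: sqrtr_ge0. Qed.

Lemma Re_le_normc z : `|complex.Re z| <= normc z.
Proof.
by case: z => a b /=; rewrite -sqrtr_sqr ler_wsqrtr // lerDl sqr_ge0.
Qed.

Lemma Im_le_normc z : `|complex.Im z| <= normc z.
Proof.
by case: z => a b /=; rewrite -sqrtr_sqr ler_wsqrtr // lerDr sqr_ge0.
Qed.

Lemma normc_le_ReIm z : normc z <= `|complex.Re z| + `|complex.Im z|.
Proof.
case: z => a b /=; rewrite -[leRHS]ger0_norm ?addr_ge0 // -sqrtr_sqr ler_wsqrtr //.
rewrite sqrrD !real_normK ?num_real //.
by rewrite lerD2r lerDl mulrn_wge0 // mulr_ge0.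
Qed.

Lemma normc_cexpi (a : R) : normc (cexpi a) = 1.
Proof. by rewrite /= cos2Dsin2 sqrtr1. Qed.

Lemma normcR (a : R) : normc a%:C = `|a|.
Proof. by rewrite /= expr0n addr0 sqrtr_sqr. Qed.

Lemma normc_conj z : normc z^* = normc z.
Proof. by case: z => a b /=; rewrite sqrrN. Qed.

Lemma ReD z w : complex.Re (z + w) = complex.Re z + complex.Re w.
Proof. by case: z; case: w. Qed.

Lemma ImD z w : complex.Im (z + w) = complex.Im z + complex.Im w.
Proof. by case: z; case: w. Qed.

Lemma ReN z : complex.Re (- z) = - complex.Re z.
Proof. by case: z. Qed.

Lemma ImN z : complex.Im (- z) = - complex.Im z.
Proof. by case: z. Qed.

Lemma ReRM (a : R) z : complex.Re (a%:C * z) = a * complex.Re z.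
Proof. by case: z => x y /=; rewrite mul0r subr0. Qed.

Lemma ImRM (a : R) z : complex.Im (a%:C * z) = a * complex.Im z.
Proof. by case: z => x y /=; rewrite mul0r addr0. Qed.

Lemma normc_triangle z w : normc (z + w) <= normc z + normc w.
Proof. exact: le_normcD. Qed.

Lemma normc_opp z : normc (- z) = normc z.
Proof. exact: normcN. Qed.

Lemma normc_sum I (r : seq I) (P : pred I) (F : I -> R[i]) :
  normc (\sum_(i <- r | P i) F i) <= \sum_(i <- r | P i) normc (F i).
Proof.
elim/big_rec2: _ => [|i y x _ xy]; first by rewrite ComplexField.Normc.normc0.
by rewrite (le_trans (normc_triangle _ _)) // lerD2l.
Qed.

End ComplexModulus.

Section PlaneWave.
Context {R : realType} {n : nat}.
Variables (k : R) (d : 'rV[R]_n.+1).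

Let c (x : 'rV[R]_n.+1) : R := cos (k * dot x d).
Let s (x : 'rV[R]_n.+1) : R := sin (k * dot x d).

Lemma is_derive_cos_dot i x : is_derive x (basis i) c (- (k * d 0 i) * s x).
Proof.
apply: is_derive_line.
have -> : (fun t : R => c (t *: basis i + x)) =
    cos \o (fun t : R => k * dot x d + t * (k * d 0 i)).
  by apply/funext => t /=; rewrite /c dotDl dotZl dot_basis; congr cos; ring.
apply: is_derive_eq.
by rewrite /GRing.scale /= mul0r addr0 -/(s x); ring.
Qed.

Lemma is_derive_sin_dot i x : is_derive x (basis i) s (k * d 0 i * c x).
Proof.
apply: is_derive_line.
have -> : (fun t : R => s (t *: basis i + x)) =
    sin \o (fun t : R => k * dot x d + t * (k * d 0 i)).
  by apply/funext => t /=; rewrite /s dotDl dotZl dot_basis; congr sin; ring.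
apply: is_derive_eq.
by rewrite /GRing.scale /= mul0r addr0 -/(c x); ring.
Qed.

Lemma is_derive2_cos_dot i x :
  is_derive x (basis i) ('D_(basis i) c) (- (k * d 0 i) ^+ 2 * c x).
Proof.
have -> : 'D_(basis i) c = (- (k * d 0 i)) *: s.
  by apply/funext => y; rewrite (@derive_val _ _ _ _ _ _ _ (is_derive_cos_dot i y)).
have ds := is_derive_sin_dot i x.
by apply: is_derive_eq; rewrite /GRing.scale /=; ring.
Qed.

Lemma is_derive2_sin_dot i x :
  is_derive x (basis i) ('D_(basis i) s) (- (k * d 0 i) ^+ 2 * s x).
Proof.
have -> : 'D_(basis i) s = (k * d 0 i) *: c.
  by apply/funext => y; rewrite (@derive_val _ _ _ _ _ _ _ (is_derive_sin_dot i y)).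
have ds := is_derive_cos_dot i x.
by apply: is_derive_eq; rewrite /GRing.scale /=; ring.
Qed.

Lemma twice_derivable_cos_dot U : twice_derivable U c.
Proof.
move=> i x _; split; first by case: (is_derive_cos_dot i x).
by case: (is_derive2_cos_dot i x).
Qed.

Lemma twice_derivable_sin_dot U : twice_derivable U s.
Proof.
move=> i x _; split; first by case: (is_derive_sin_dot i x).
by case: (is_derive2_sin_dot i x).
Qed.

Hypothesis d_unit : enorm d = 1.

Lemma sum_sqr_unit (a : R) : \sum_i - (k * d 0 i) ^+ 2 * a = - k ^+ 2 * a.
Proof.
rewrite -mulr_suml; congr (_ * _).
under eq_bigr do rewrite exprMn -mulNr.
have d1 : \sum_i d 0 i ^+ 2 = 1 by rewrite -(expr1n R 2) -d_unit sqr_enorm.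
by rewrite -mulr_sumr d1 mulr1.
Qed.

Lemma lap_cos_dot : lap c = (- k ^+ 2) *: c.
Proof.
apply/funext => x; rewrite /lap.
under eq_bigr do rewrite (@derive_val _ _ _ _ _ _ _ (is_derive2_cos_dot _ x)).
exact: sum_sqr_unit.
Qed.

Lemma lap_sin_dot : lap s = (- k ^+ 2) *: s.
Proof.
apply/funext => x; rewrite /lap.
under eq_bigr do rewrite (@derive_val _ _ _ _ _ _ _ (is_derive2_sin_dot _ x)).
exact: sum_sqr_unit.
Qed.

End PlaneWave.

Section RealParts.
Context {R : realType}.
Implicit Types (u : 'rV[R]_3 -> R[i]) (x : 'rV[R]_3).

Lemma Re_laplacian u : (fun x => complex.Re (laplacian u x)) =
  lap (fun y => complex.Re (u y)).
Proof.
by apply/funext => x; rewrite /laplacian /lap; exact: (big_morph _ ReD).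
Qed.

Lemma Im_laplacian u : (fun x => complex.Im (laplacian u x)) =
  lap (fun y => complex.Im (u y)).
Proof.
by apply/funext => x; rewrite /laplacian /lap; exact: (big_morph _ ImD).
Qed.

End RealParts.

Section ModifiedHelmholtz.
Context {R : realType} {n : nat}.
Variables (k : R) (U : set 'rV[R]_n.+1) (oU : open U).
Implicit Types (g p : 'rV[R]_n.+1 -> R).

Lemma class_C_le m m' g : (m <= m')%N -> class_C m' U g -> class_C m U g.
Proof.
move=> mm' Cg s sm; have [cs ds] := Cg s (leq_trans sm mm').
by split=> // lt_sm; apply: ds; exact: leq_trans lt_sm mm'.
Qed.

(** The component of [g] that solves the modified Helmholtz equation
    [lap w = k ^+ 2 * w], when [g] solves [lap (lap g) = k ^+ 4 * g]. *)
Definition modified_part g : 'rV[R]_n.+1 -> R :=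
  2^-1 *: (g + (k ^+ 2)^-1 *: lap g).

(** A function [p] with [lap p = - k ^+ 2 * p] also satisfies
    [lap (lap p) = k ^+ 4 * p], so it can be removed from the total field. *)
Lemma bilaplacian_add_plane_wave g p :
  class_C 4 U g -> twice_derivable U p -> lap p = (- k ^+ 2) *: p ->
  (forall x, U x -> lap (lap (p + g)) x - k ^+ 4 * (p x + g x) = 0) ->
  forall x, U x -> lap (lap g) x = k ^+ 4 * g x.
Proof.
move=> Cg dp lapp H x Ux.
have dg : twice_derivable U g.
  exact: class_C_twice_derivable (class_C_le _ Cg).
have dlg := class_C4_lap_twice_derivable oU Cg.
have E : lap (lap (p + g)) x = k ^+ 4 * p x + lap (lap g) x.
  transitivity (lap ((- k ^+ 2) *: p + lap g) x).
    refine (lap_eq_on oU _ Ux) => y Uy.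
    by rewrite (lapD oU dp dg Uy) lapp.
  rewrite (lapD oU (twice_derivableZ _ oU dp) dlg Ux) (lapZ _ oU dp Ux) lapp.
  by rewrite !fctE /GRing.scale /=; ring.
have /eqP := etrans (congr1 (fun z => z - k ^+ 4 * (p x + g x)) (esym E)) (H x Ux).
by rewrite mulrDr opprD addrACA subrr add0r subr_eq0 => /eqP.
Qed.

Hypothesis k_gt0 : 0 < k.
Variable g : 'rV[R]_n.+1 -> R.
Hypothesis Cg : class_C 4 U g.

Lemma class_C4_twice_derivable : twice_derivable U g.
Proof.
exact: class_C_twice_derivable (class_C_le _ Cg).
Qed.

Lemma modified_part_twice_derivable : twice_derivable U (modified_part g).
Proof.
have dg := class_C4_twice_derivable.
have dlg := class_C4_lap_twice_derivable oU Cg.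
exact: (twice_derivableZ _ oU (twice_derivableD oU dg (twice_derivableZ _ oU dlg))).
Qed.

Lemma modified_part_continuous x : U x -> {for x, continuous (modified_part g)}.
Proof.
move=> Ux.
have gx : g y @[y --> x] --> g x := class_C_continuous Cg Ux.
have lx : lap g y @[y --> x] --> lap g x := class_C4_lap_continuous Cg Ux.
exact: (cvgZl_tmp (k := 2^-1) (cvgD gx (cvgZl_tmp (k := (k ^+ 2)^-1) lx))).
Qed.

Lemma lap_modified_part :
  (forall x, U x -> lap (lap g) x = k ^+ 4 * g x) ->
  forall x, U x -> lap (modified_part g) x = k ^+ 2 * modified_part g x.
Proof.
move=> H x Ux; have dg := class_C4_twice_derivable.
have dlg := class_C4_lap_twice_derivable oU Cg.
have dZ := twice_derivableZ (k ^+ 2)^-1 oU dlg.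
rewrite (lapZ _ oU (twice_derivableD oU dg dZ) Ux) (lapD oU dg dZ Ux).
rewrite (lapZ _ oU dlg Ux) (H x Ux) /modified_part !fctE /GRing.scale /=.
by field; rewrite gt_eqF.
Qed.

End ModifiedHelmholtz.

(** * Growth of radiating fields along rays *)

Section Rays.
Context {R : realType} {n : nat}.
Implicit Types (g : 'rV[R]_n.+1 -> R) (x v : 'rV[R]_n.+1).

Lemma enorm_dir x : 0 < enorm x -> enorm (dir x) = 1.
Proof.
by move=> x0; rewrite enormZ ger0_norm ?invr_ge0 ?ltW // mulVf ?gt_eqF.
Qed.

Lemma enormZ_unit v t : enorm v = 1 -> 0 <= t -> enorm (t *: v) = t.
Proof. by move=> v1 t0; rewrite enormZ v1 mulr1 ger0_norm. Qed.

Lemma dirZ v t : enorm v = 1 -> 0 < t -> dir (t *: v) = v.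
Proof.
by move=> v1 t0; rewrite /dir enormZ_unit ?ltW // scalerA mulVf ?gt_eqF // scale1r.
Qed.

Lemma enorm_dirK x : 0 < enorm x -> x = enorm x *: dir x.
Proof. by move=> x0; rewrite /dir scalerA divff ?gt_eqF // scale1r. Qed.

Lemma class_C_derivable U g x v : open U -> class_C 1 U g -> U x ->
  derivable g x v.
Proof.
move=> oU Cg Ux; suff : is_derive x v g (\sum_i v 0 i * 'D_(basis i) g x) by case.
apply: is_derive_partials => i; last exact: (Cg [:: i] isT).1.
have : nbhs x U by exact: open_nbhs_nbhs.
by apply: filterS => y; exact: ((Cg [::] isT).2 isT i y).
Qed.

Lemma is_derive_ray g v (t : R) : derivable g (t *: v) v ->
  is_derive t 1 (fun s : R => g (s *: v)) ('D_v g (t *: v)).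
Proof.
have -> : (fun s : R => g (s *: v)) = (fun s : R => g (s *: v + 0)).
  by apply/funext => s; rewrite addr0.
move=> dg; have := derivable_line g 0 v t; have := derive_line g 0 v t.
by rewrite addr0 => -> -[/(_ dg) + _] => /derivableP.
Qed.

End Rays.

Section Growth.
Context {R : realType}.
Variables (U : set 'rV[R]_3) (r0 : R).
Hypothesis oU : open U.
Hypothesis rU : forall x, r0 <= enorm x -> U x.
Variables (k : R) (us : 'rV[R]_3 -> R[i]).
Hypothesis us_C4 : cclass_C 4 U us.

(** Derivatives of the real and imaginary parts of [exp (- i k t) us (t v)]: the
    factor [exp (- i k t)] turns the radiation condition into a bound on the
    derivative along the ray. *)
Lemma is_derive_demodulated (v : 'rV[R]_3) (t : R) : U (t *: v) ->
  let a := fun x => complex.Re (us x) in let b := fun x => complex.Im (us x) in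
  is_derive t 1 (fun t => cos (k * t) * a (t *: v) + sin (k * t) * b (t *: v))
    (complex.Re ((cexpi (k * t))^* *
      (cderive v us (t *: v) - 'i * k%:C * us (t *: v)))) /\
  is_derive t 1 (fun t => cos (k * t) * b (t *: v) - sin (k * t) * a (t *: v))
    (complex.Im ((cexpi (k * t))^* *
      (cderive v us (t *: v) - 'i * k%:C * us (t *: v)))).
Proof.
move=> Utv a b.
have da : is_derive t 1 (fun s : R => a (s *: v)) ('D_v a (t *: v)).
  have C1 : class_C 1 U a := class_C_le (isT : (1 <= 4)%N) us_C4.1.
  exact: (is_derive_ray (@class_C_derivable _ _ U _ _ v oU C1 Utv)).
have db : is_derive t 1 (fun s : R => b (s *: v)) ('D_v b (t *: v)).
  have C1 : class_C 1 U b := class_C_le (isT : (1 <= 4)%N) us_C4.2.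
  exact: (is_derive_ray (@class_C_derivable _ _ U _ _ v oU C1 Utv)).
have dk : is_derive t 1 (fun s : R => k * s) k.
  by apply: is_derive_eq; rewrite /GRing.scale /= mulr1.
have dc : is_derive t 1 (fun s : R => cos (k * s)) (- sin (k * t) * k).
  exact: (@is_derive1_comp _ cos).
have ds : is_derive t 1 (fun s : R => sin (k * s)) (cos (k * t) * k).
  exact: (@is_derive1_comp _ sin).
rewrite /cderive -/a -/b.
have -> : us (t *: v) = a (t *: v) +i* b (t *: v) by rewrite /a /b; case: us.
split.
  by apply: is_derive_eq; rewrite /GRing.scale /=; ring.
by apply: is_derive_eq; rewrite /GRing.scale /=; ring.
Qed.

(** A linear bound suffices here, although the radiation condition gives a
    logarithmic one. *)
Lemma radiating_growth : radiating k us ->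
  exists r1 C, [/\ r0 <= r1, 0 <= C & forall x, r1 <= enorm x ->
    `|complex.Re (us x)| <= C * (1 + enorm x) /\
    `|complex.Im (us x)| <= C * (1 + enorm x)].
Proof.
move=> /cvgrPdist_le/(_ 1 ltr01)[r rP].
pose r1 := Num.max r0 (Num.max r 1).
have r1r0 : r0 <= r1 by rewrite le_max lexx.
have r1r : r <= r1 by rewrite !le_max lexx orbT.
have r11 : 1 <= r1 by rewrite !le_max lexx !orbT.
have aU x : r1 <= enorm x <= r1 -> U x.
  by move=> /andP[r1x _]; apply: rU; exact: le_trans r1x.
have [Ma [Ma0 MaP]] :=
  bounded_on_annulus (fun x => @class_C_continuous _ _ _ _ _ x us_C4.1) aU.
have [Mb [Mb0 MbP]] :=
  bounded_on_annulus (fun x => @class_C_continuous _ _ _ _ _ x us_C4.2) aU.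
pose C := 2 * (Ma + Mb + 1).
exists r1, C; split=> //; first by rewrite /C; lra.
move=> x r1x; pose v := dir x; pose T := enorm x.
have x0 : 0 < enorm x by lra.
have v1 : enorm v = 1 by exact: enorm_dir.
have radial t : r1 <= t ->
    normc ((cexpi (k * t))^* *
      (cderive v us (t *: v) - 'i * k%:C * us (t *: v))) <= 1.
  move=> r1t; have t0 : 0 < t by lra.
  have tE : enorm (t *: v) = t by rewrite enormZ_unit // ltW.
  have := rP (t *: v); rewrite tE dirZ // sub0r normrN => /(_ (le_trans r1r r1t)).
  rewrite ComplexField.Normc.normcM normc_conj normc_cexpi mul1r.
  set N := normc _; have N0 : 0 <= N by exact: normc_ge0.
  rewrite ger0_norm; last by rewrite mulr_ge0 // ltW.
  move=> tN.
  by rewrite (le_trans _ tN) // ler_peMl //; lra.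
have Uv (t : R) : r1 <= t -> U (t *: v).
  by move=> r1t; apply: rU; rewrite enormZ_unit //; lra.
pose a t := complex.Re (us (t *: v)); pose b t := complex.Im (us (t *: v)).
have r1v : enorm (r1 *: v) = r1 by rewrite enormZ_unit //; lra.
have ar1 : `|a r1| <= Ma by apply: MaP; rewrite r1v lexx.
have br1 : `|b r1| <= Mb by apply: MbP; rewrite r1v lexx.
have bound (h h' : R -> R) : (forall t, r1 <= t -> is_derive t 1 h (h' t)) ->
    (forall t, r1 <= t -> `|h' t| <= 1) -> `|h r1| <= Ma + Mb ->
    `|h T| <= Ma + Mb + (T - r1).
  move=> dh h'1 hr1.
  have [||c cT hE] := @MVT_segment R h h' r1 T r1x.
  - by move=> t; rewrite in_itv /= => /andP[/ltW r1t _]; exact: dh.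
  - apply: continuous_in_subspaceT => t; rewrite inE /= in_itv /= => /andP[r1t _].
    by have [/derivable1_diffP/differentiable_continuous] := dh t r1t.
  have -> : h T = h r1 + h' c * (T - r1) by rewrite -hE; ring.
  rewrite (le_trans (ler_normD _ _)) // lerD // normrM.
  move: cT; rewrite in_itv /= => /andP[r1c _].
  by rewrite [`|T - r1|]ger0_norm ?subr_ge0 // ler_piMl ?subr_ge0 // h'1.
have cos1 t := cos_max (k * t); have sin1 t := sin_max (k * t).
have comb (p q y z Y Z : R) : `|p| <= 1 -> `|q| <= 1 -> `|y| <= Y -> `|z| <= Z ->
    `|p * y + q * z| <= Y + Z.
  move=> p1 q1 yY zZ; rewrite (le_trans (ler_normD _ _)) // !normrM.
  by apply: lerD; rewrite -[leRHS]mul1r ler_pM.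
have hT1 : `|cos (k * T) * a T + sin (k * T) * b T| <= Ma + Mb + (T - r1).
  apply: (bound _ _ (fun t r1t =>
    (is_derive_demodulated (Uv t r1t)).1)) => [t r1t|].
    by rewrite (le_trans (Re_le_normc _)) // radial.
  exact: comb.
have hT2 : `|cos (k * T) * b T - sin (k * T) * a T| <= Ma + Mb + (T - r1).
  apply: (bound _ _ (fun t r1t =>
    (is_derive_demodulated (Uv t r1t)).2)) => [t r1t|].
    by rewrite (le_trans (Im_le_normc _)) // radial.
  by rewrite -mulNr [Ma + Mb]addrC; apply: comb; rewrite ?normrN.
(* [h1] and [h2] are rotated back by the angle [k * T]. *)
set h1 := cos (k * T) * a T + _ in hT1; set h2 := cos (k * T) * b T - _ in hT2.
have TC : (Ma + Mb + (T - r1)) + (Ma + Mb + (T - r1)) <= C * (1 + T).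
  have : 0 <= (Ma + Mb) * T by rewrite mulr_ge0 ?addr_ge0 // ltW.
  by rewrite /C; lra.
have cs := cos2Dsin2 (k * T).
have aE : complex.Re (us x) = cos (k * T) * h1 + (- sin (k * T)) * h2.
  rewrite {1}(enorm_dirK x0) -/(a T) -[LHS]mul1r -cs /h1 /h2; ring.
have bE : complex.Im (us x) = cos (k * T) * h2 + sin (k * T) * h1.
  rewrite {1}(enorm_dirK x0) -/(b T) -[LHS]mul1r -cs /h1 /h2; ring.
rewrite aE bE; split; apply: (le_trans _ TC); apply: comb => //.
by rewrite normrN.
Qed.

End Growth.

(** * Decay of the modified Helmholtz part *)

Lemma modified_partE {R : realType} {n} (k : R) (g : 'rV[R]_n.+1 -> R) x :
  modified_part k g x = 2^-1 * (g x + (k ^+ 2)^-1 * lap g x).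
Proof. by []. Qed.

Section HelmholtzPart.
Context {R : realType}.
Variables (k : R) (us : 'rV[R]_3 -> R[i]).

Let a x := complex.Re (us x).
Let b x := complex.Im (us x).

(** The two parts of the field: [us = u_H + u_M]. *)
Lemma helmholtz_part_split x :
  us x = helmholtz_part k us x + (modified_part k a x +i* modified_part k b x).
Proof.
have lapE : laplacian us x = lap a x +i* lap b x.
  apply/eqP; rewrite eq_complex /=; apply/andP; split; apply/eqP.
    exact: (congr1 (@^~ x) (Re_laplacian us)).
  exact: (congr1 (@^~ x) (Im_laplacian us)).
rewrite /helmholtz_part lapE !modified_partE.
have -> : us x = a x +i* b x by rewrite /a /b; case: us.
move: (lap a x) (lap b x) (a x) (b x) => la lb ax bx.
rewrite -(rmorph_nat (real_complex R)) -!fmorphV /=.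
by apply/eqP; rewrite eq_complex /=; apply/andP; split; apply/eqP;
  move: (k ^- 2) => j; field.
Qed.

Variables (U : set 'rV[R]_3) (r0 : R).
Hypotheses (oU : open U) (r0_gt0 : 0 < r0).
Hypothesis rU : forall x, r0 <= enorm x -> U x.
Hypothesis us_C4 : cclass_C 4 U us.
Hypothesis k_gt0 : 0 < k.

(** The expansion with one term gives a bound on [u_H] uniform in the direction
    once [f 1] is bounded; the values of [u_H] on one sphere, which is compact,
    bound [f 1]. *)
Lemma helmholtz_part_bounded f : atkinson_coefficients k f (helmholtz_part k us) ->
  exists r1 K, [/\ r0 <= r1, 0 <= K &
    forall x, r1 <= enorm x -> normc (helmholtz_part k us x) <= K].
Proof.
move=> /(_ 1%N isT)[g [M [r rP]] [r' r'P]].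
pose r1 := Num.max r0 (Num.max r (Num.max r' 1)).
have r1r0 : r0 <= r1 by rewrite le_max lexx.
have r1r : r <= r1 by rewrite !le_max lexx orbT.
have r1r' : r' <= r1 by rewrite !le_max lexx !orbT.
have r11 : 1 <= r1 by rewrite !le_max lexx !orbT.
have aU x : r1 <= enorm x <= r1 -> U x.
  by move=> /andP[r1x _]; apply: rU; exact: le_trans r1x.
have ca x : U x -> {for x, continuous (a - modified_part k a)}.
  move=> Ux; have ax : a y @[y --> x] --> a x := class_C_continuous us_C4.1 Ux.
  have mx : modified_part k a y @[y --> x] --> modified_part k a x.
    exact: (modified_part_continuous us_C4.1).
  exact: (cvgB ax mx).
have cb x : U x -> {for x, continuous (b - modified_part k b)}.
  move=> Ux; have bx : b y @[y --> x] --> b x := class_C_continuous us_C4.2 Ux.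
  have mx : modified_part k b y @[y --> x] --> modified_part k b x.
    exact: (modified_part_continuous us_C4.2).
  exact: (cvgB bx mx).
have [Ma [Ma0 MaP]] := bounded_on_annulus ca aU.
have [Mb [Mb0 MbP]] := bounded_on_annulus cb aU.
pose S := Ma + Mb.
have uS y : enorm y = r1 -> normc (helmholtz_part k us y) <= S.
  move=> yr; rewrite (le_trans (normc_le_ReIm _)) // /S.
  have -> : helmholtz_part k us y =
      us y - (modified_part k a y +i* modified_part k b y).
    by apply/eqP; rewrite eq_sym subr_eq; apply/eqP; exact: helmholtz_part_split.
  rewrite ReD ImD /=; apply: lerD; [apply: MaP|apply: MbP]; by rewrite yr lexx.
have hN y : r1 <= enorm y ->
    normc (f 1%N (dir y) + g y) = enorm y * normc (helmholtz_part k us y).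
  move=> r1y; have y0 : 0 < enorm y by lra.
  rewrite (r'P y (le_trans r1r' r1y)) big_nat1 expr0 divr1.
  rewrite !ComplexField.Normc.normcM normc_cexpi mul1r.
  rewrite ComplexField.Normc.normcV normcR.
  by rewrite ger0_norm ?ltW // mulrA divff ?gt_eqF // mul1r.
have gM y : r1 <= enorm y -> normc (g y) <= `|M|.
  move=> r1y; rewrite (le_trans (rP y (le_trans r1r r1y))) //.
  rewrite (le_trans (ler_norm _)) //.
  rewrite normrM ler_piMr // expr1 normfV invf_le1 ?normr_gt0 ?gt_eqF //; last lra.
  by rewrite ger0_norm; lra.
exists r1, (r1 * S + `|M| + `|M|); split=> //.
  by rewrite !addr_ge0 // mulr_ge0 ?addr_ge0 //; lra.
move=> x r1x; have x0 : 0 < enorm x by lra.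
pose y := r1 *: dir x.
have yr : enorm y = r1 by rewrite enormZ_unit ?enorm_dir //; lra.
have dy : dir y = dir x by rewrite dirZ ?enorm_dir //; lra.
have r1y : r1 <= enorm y by rewrite yr.
have f1 : normc (f 1%N (dir x)) <= r1 * S + `|M|.
  have -> : f 1%N (dir x) = (f 1%N (dir y) + g y) + - g y by rewrite dy addrK.
  rewrite (le_trans (normc_triangle _ _)) // normc_opp.
  apply: lerD; last exact: gM.
  by rewrite hN // yr ler_wpM2l ?uS //; lra.
have := hN x r1x; have := normc_triangle (f 1%N (dir x)) (g x).
have := gM x r1x; set N := normc (helmholtz_part k us x).
have N0 : 0 <= N by exact: normc_ge0.
have : N <= enorm x * N by rewrite ler_peMl //; lra.
lra.
Qed.

Lemma modified_part_decay g (C r1 : R) m : r0 <= r1 -> class_C 4 U g ->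
  (forall x, U x -> lap (lap g) x = k ^+ 4 * g x) ->
  (forall x, r1 <= enorm x -> `|modified_part k g x| <= C * (1 + enorm x)) ->
  exists A r2, forall x, r2 <= enorm x ->
    `|modified_part k g x| <= A * (enorm x)^-1 ^+ (2 * m).
Proof.
move=> r01 Cg lapg growth; set w := modified_part k g.
have r1_gt0 : 0 < r1 by exact: lt_le_trans r01.
have r1U x : r1 <= enorm x -> U x by move=> ?; apply: rU; exact: le_trans r01 _.
have dw := modified_part_twice_derivable k oU Cg.
have cw x : U x -> {for x, continuous w} :=
  @modified_part_continuous _ _ k _ _ Cg x.
have lapw := lap_modified_part oU k_gt0 Cg lapg.
have lw x : U x -> k ^+ 2 * w x <= lap w x by move=> Ux; rewrite lapw.
have [A1 [s1 P1]] := decay_of_subsolution m k_gt0 r1_gt0 oU r1U cw dw lw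
  (fun x r1x => le_trans (ler_norm _) (growth x r1x)).
have dw' := twice_derivableZ (- 1) oU dw.
have cw' x : U x -> {for x, continuous ((- 1) *: w)}.
  move=> Ux; have wx : w y @[y --> x] --> w x := cw x Ux.
  exact: (cvgZl_tmp (k := - 1) wx).
have lw' x : U x -> k ^+ 2 * ((- 1) *: w) x <= lap ((- 1) *: w) x.
  by move=> Ux; rewrite (lapZ _ oU dw Ux) lapw // !fctE /GRing.scale /=; lra.
have [|A2 [s2 P2]] :=
    decay_of_subsolution (B := C) m k_gt0 r1_gt0 oU r1U cw' dw' lw'.
  move=> x r1x; rewrite fctE /GRing.scale /= mulN1r.
  by rewrite (le_trans (ler_norm _)) // normrN growth.
exists (Num.max A1 A2), (Num.max (Num.max s1 s2) 0) => x.
rewrite !ge_max => /andP[/andP[s1x s2x] x0].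
have p0 : 0 <= (enorm x)^-1 ^+ (2 * m) by rewrite exprn_ge0 // invr_ge0.
rewrite ler_norml lerNl; apply/andP; split.
  have := P2 x s2x; rewrite fctE /GRing.scale /= mulN1r => /le_trans; apply.
  by rewrite ler_wpM2r // le_max lexx orbT.
by rewrite (le_trans (P1 x s1x)) // ler_wpM2r // le_max lexx.
Qed.

End HelmholtzPart.

Section Scattering.
Context {R : realType}.
Variables (k : R) (D : set 'rV[R]_3) (d : 'rV[R]_3) (us : 'rV[R]_3 -> R[i]).
Variable f : nat -> 'rV[R]_3 -> R[i].
Hypotheses (k_gt0 : 0 < k) (D_bounded : bounded_set D) (d_unit : enorm d = 1).
Hypothesis us_C4 : cclass_C 4 (exterior D) us.
Hypothesis u_wave : biharmonic_wave k (exterior D) (total_field k d us).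
Hypothesis us_radiating : radiating k us.
Hypothesis f_atkinson : atkinson_coefficients k f (helmholtz_part k us).

Lemma open_exterior : open (exterior D).
Proof. exact/closed_openC/closed_closure. Qed.

Lemma bilaplacian_scattered x : exterior D x ->
  lap (lap (fun y => complex.Re (us y))) x = k ^+ 4 * complex.Re (us x) /\
  lap (lap (fun y => complex.Im (us y))) x = k ^+ 4 * complex.Im (us x).
Proof.
have reE : (fun y => complex.Re (laplacian (laplacian (total_field k d us)) y)) =
    lap (lap ((fun y => cos (k * dot y d)) + (fun y => complex.Re (us y)))).
  by rewrite !Re_laplacian; congr (lap (lap _)); apply/funext => y; rewrite ReD.
have imE : (fun y => complex.Im (laplacian (laplacian (total_field k d us)) y)) =
    lap (lap ((fun y => sin (k * dot y d)) + (fun y => complex.Im (us y)))).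
  by rewrite !Im_laplacian; congr (lap (lap _)); apply/funext => y; rewrite ImD.
move=> Ux; split.
  refine (bilaplacian_add_plane_wave open_exterior us_C4.1
    (@twice_derivable_cos_dot _ _ k d _) (lap_cos_dot k d_unit) _ Ux) => y Uy.
  rewrite -reE; apply: (etrans _ (congr1 (@complex.Re R) (u_wave Uy))).
  by rewrite [RHS]ReD ReN ReRM [in RHS]ReD.
refine (bilaplacian_add_plane_wave open_exterior us_C4.2
  (@twice_derivable_sin_dot _ _ k d _) (lap_sin_dot k d_unit) _ Ux) => y Uy.
rewrite -imE; apply: (etrans _ (congr1 (@complex.Im R) (u_wave Uy))).
by rewrite [RHS]ImD ImN ImRM [in RHS]ImD.
Qed.

(** [u_M = us - u_H] decays faster than any power of the distance. *)
Lemma scattered_field_asymptotics m : exists A r, forall x, r <= enorm x ->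
  normc (us x - helmholtz_part k us x) <= A * (enorm x)^-1 ^+ (2 * m).
Proof.
have oU := open_exterior.
have [r0 [r00 rU]] := exterior_infty D_bounded.
have [r1 [C [r01 C0 growth]]] := radiating_growth oU rU us_C4 us_radiating.
have [r2 [K [r02 K0 Hb]]] := helmholtz_part_bounded rU us_C4 f_atkinson.
pose r3 := Num.max r1 r2.
have r03 : r0 <= r3 by rewrite le_max r01.
have mE x := helmholtz_part_split k us x.
have mRe x : r3 <= enorm x ->
    `|modified_part k (fun y => complex.Re (us y)) x| <= (C + K) * (1 + enorm x).
  rewrite ge_max => /andP[r1x r2x].
  have -> : modified_part k (fun y => complex.Re (us y)) x =
      complex.Re (us x) - complex.Re (helmholtz_part k us x).
    by rewrite mE ReD addrC addKr.
  rewrite (le_trans (ler_normB _ _)) // mulrDl lerD //.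
    exact: (growth x r1x).1.
  rewrite (le_trans (Re_le_normc _)) // (le_trans (Hb x r2x)) // ler_peMr // lerDl.
  exact: enorm_ge0.
have mIm x : r3 <= enorm x ->
    `|modified_part k (fun y => complex.Im (us y)) x| <= (C + K) * (1 + enorm x).
  rewrite ge_max => /andP[r1x r2x].
  have -> : modified_part k (fun y => complex.Im (us y)) x =
      complex.Im (us x) - complex.Im (helmholtz_part k us x).
    by rewrite mE ImD addrC addKr.
  rewrite (le_trans (ler_normB _ _)) // mulrDl lerD //.
    exact: (growth x r1x).2.
  rewrite (le_trans (Im_le_normc _)) // (le_trans (Hb x r2x)) // ler_peMr // lerDl.
  exact: enorm_ge0.
have [A1 [s1 P1]] := modified_part_decay oU r00 rU k_gt0 m r03 us_C4.1
  (fun x Ux => (bilaplacian_scattered Ux).1) mRe.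
have [A2 [s2 P2]] := modified_part_decay oU r00 rU k_gt0 m r03 us_C4.2
  (fun x Ux => (bilaplacian_scattered Ux).2) mIm.
exists (A1 + A2), (Num.max s1 s2) => x; rewrite ge_max => /andP[s1x s2x].
rewrite {1}mE addrC addKr (le_trans (normc_le_ReIm _)) //= mulrDl.
by rewrite lerD ?P1 ?P2.
Qed.

End Scattering.

(** * Expansion of the phaseless data *)

Section Decay.
Context {R : realType}.
Implicit Types (f g : R -> R[i]) (m p : nat).

(** [f t = O(t ^- m)] as [t] tends to infinity. *)
Definition decays m f : Prop := bigO_at +oo f (fun t => t ^- m).

Lemma decaysP m f : decays m f ->
  exists2 M, 0 <= M & \forall t \near +oo, normc (f t) <= M * t ^- m.
Proof.
move=> [M fM]; exists `|M| => //; near=> t.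
have t0 : 0 < t by near: t; exact: nbhs_pinfty_gt.
apply: (@le_trans _ _ (M * t ^- m)); first by near: t.
by rewrite ler_wpM2r ?ler_norm // invr_ge0 exprn_ge0 // ltW.
Unshelve. all: by end_near. Qed.

Lemma decays_eq m f g : (\forall t \near +oo, f t = g t) ->
  decays m f -> decays m g.
Proof.
move=> fg [M fM]; exists M; near=> t.
have <- : f t = g t by near: t.
by near: t.
Unshelve. all: by end_near. Qed.

Lemma decaysD m f g : decays m f -> decays m g -> decays m (fun t => f t + g t).
Proof.
move=> [M fM] [N gN]; exists (M + N); near=> t.
rewrite (le_trans (normc_triangle _ _)) // mulrDl lerD //.
  by near: t.
by near: t.
Unshelve. all: by end_near. Qed.

Lemma decaysN m f : decays m f -> decays m (fun t => - f t).
Proof.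
by move=> [M fM]; exists M; apply: filterS fM => t; rewrite normc_opp.
Qed.

Lemma decays_conj m f : decays m f -> decays m (fun t => (f t)^*%C).
Proof.
by move=> [M fM]; exists M; apply: filterS fM => t; rewrite normc_conj.
Qed.

Lemma decays_cst (c : R[i]) : decays 0 (fun=> c).
Proof.
by exists (normc c); near=> t; rewrite expr0 invr1 mulr1.
Unshelve. all: by end_near. Qed.

Lemma decaysM m p f g : decays m f -> decays p g ->
  decays (m + p) (fun t => f t * g t).
Proof.
move=> /decaysP[M M0 fM] /decaysP[N N0 gN]; exists (M * N); near=> t.
rewrite ComplexField.Normc.normcM exprD invfM mulrACA ler_pM ?normc_ge0 //.
  by near: t.
by near: t.
Unshelve. all: by end_near. Qed.

Lemma decays_le m p f : (m <= p)%N -> decays p f -> decays m f.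
Proof.
move=> mp /decaysP[M M0 fM]; exists M; near=> t.
have t1 : 1 <= t by near: t; exact: nbhs_pinfty_ge.
have t0 : 0 < t by exact: lt_le_trans t1.
apply: (@le_trans _ _ (M * t ^- p)); first by near: t.
by rewrite ler_wpM2l // lef_pV2 ?posrE ?exprn_gt0 // ler_weXn2l.
Unshelve. all: by end_near. Qed.

Lemma decays_sum m a b (F : nat -> R -> R[i]) :
  (forall l, (a <= l < b)%N -> decays m (F l)) ->
  decays m (fun t => \sum_(a <= l < b) F l t).
Proof.
elim: b => [|b IH] H.
  apply: (@decays_eq m (fun=> 0)); first by near=> t; rewrite big_geq.
  by exists 0; near=> t; rewrite ComplexField.Normc.normc0 mul0r.
have [ab|ba] := leqP a b; last first.
  apply: (@decays_eq m (fun=> 0)); first by near=> t; rewrite big_geq.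
  by exists 0; near=> t; rewrite ComplexField.Normc.normc0 mul0r.
apply: (@decays_eq m (fun t => \sum_(a <= l < b) F l t + F b t)).
  by near=> t; rewrite big_nat_recr.
apply: decaysD; last by apply: H; rewrite ab ltnSn.
by apply: IH => l /andP[al lb]; apply: H; rewrite al ltnS ltnW.
Unshelve. all: by end_near. Qed.

End Decay.

Lemma cexpiMconj {R : realType} (a : R) : cexpi a * (cexpi a)^*%C = 1.
Proof. by rewrite -cexpiN -cexpiD subrr /cexpi cos0 sin0. Qed.

Lemma conjcM {R : realType} (z w : R[i]) : (z * w)^*%C = z^*%C * w^*%C.
Proof. exact: (rmorphM (@conjc R)). Qed.

Lemma conjcD {R : realType} (z w : R[i]) : (z + w)^*%C = z^*%C + w^*%C.
Proof. exact: (rmorphD (@conjc R)). Qed.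

Lemma conjcN {R : realType} (z : R[i]) : (- z)^*%C = - z^*%C.
Proof. exact: (rmorphN (@conjc R)). Qed.

(** The intensity of the sum of a wave [e1] of modulus 1 and a wave
    [e * e1 * z * w], where [z = s^-1]: the phase [e1] cancels. *)
Lemma interference_identity {R : realType} (s e e1 z w : R[i]) :
  e * e^*%C = 1 -> e1 * e1^*%C = 1 -> z^*%C = z -> s * z = 1 ->
  s * ((e1 + e * e1 * z * w) * (e1 + e * e1 * z * w)^*%C - 1) =
  e * w + (e * w)^*%C + z * (w * w^*%C).
Proof.
move=> ee e1e1 zz sz; rewrite conjcD !conjcM zz.
transitivity (s * (e1 * e1^*%C - 1) +
  (s * z) * (e1 * e1^*%C) * (e * w + e^*%C * w^*%C) +
  (s * z) * z * (e * e^*%C) * (e1 * e1^*%C) * (w * w^*%C)); first by ring.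
by rewrite ee e1e1 sz; ring.
Qed.

Section PolynomialTail.
Context {R : realType}.

Lemma normcX (z : R[i]) n : normc (z ^+ n) = normc z ^+ n.
Proof.
elim: n => [|n IH]; first by rewrite !expr0 ComplexField.Normc.normc1.
by rewrite !exprS ComplexField.Normc.normcM IH.
Qed.

Lemma horner_bounded (p : {poly R[i]}) (z : R[i]) : normc z <= 1 ->
  normc p.[z] <= \sum_(i < size p) normc p`_i.
Proof.
move=> z1; rewrite horner_coef (le_trans (normc_sum _ _ _)) // ler_sum // => i _.
rewrite ComplexField.Normc.normcM normcX ler_piMr ?normc_ge0 //.
by rewrite exprn_ile1 ?normc_ge0.
Qed.

Lemma horner_tail (p : {poly R[i]}) n : exists2 K, 0 <= K &
  forall z, normc z <= 1 ->
    normc (p.[z] - \sum_(i < n) p`_i * z ^+ i) <= K * normc z ^+ n.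
Proof.
pose q := drop_poly n p; exists (\sum_(i < size q) normc q`_i).
  by apply: sumr_ge0 => i _; exact: normc_ge0.
move=> z z1.
have -> : p.[z] = \sum_(i < n) p`_i * z ^+ i + q.[z] * z ^+ n.
  rewrite -{1}(poly_take_drop n p) hornerD hornerM hornerXn; congr (_ + _).
  rewrite (horner_coef_wide _ (size_take_poly n p)); apply: eq_bigr => i _.
  by rewrite coef_take_poly ltn_ord.
rewrite addrC addKr ComplexField.Normc.normcM normcX.
by rewrite ler_wpM2r ?exprn_ge0 ?normc_ge0 // horner_bounded.
Qed.

End PolynomialTail.

Section PhaselessExpansion.
Context {R : realType}.
Variables (k : R) (d : 'rV[R]_3) (us : 'rV[R]_3 -> R[i]).
Variable f : nat -> 'rV[R]_3 -> R[i].
Variables (n : nat) (n_gt0 : (0 < n)%N) (xh : 'rV[R]_3) (xh_unit : enorm xh = 1).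
Hypothesis f_atkinson : atkinson_coefficients k f (helmholtz_part k us).
Hypothesis remainder : forall m, exists A r, forall x, r <= enorm x ->
  normc (us x - helmholtz_part k us x) <= A * (enorm x)^-1 ^+ (2 * m).

(** The [j]-th coefficient of the expansion of [s * (|u (s xh)|^2 - 1)] in
    powers of [1 / s], where [e] is the unimodular factor
    [exp (i k s (1 - xh . d))]. *)
Definition phaseless_coef (e : R[i]) (j : nat) : R[i] :=
  e * f j xh + (e * f j xh)^*%C + \sum_(1 <= l < j) f l xh * (f (j - l)%N xh)^*%C.

(* The truncated expansion of [u_H] and its conjugate, as polynomials in [1 / s].
   The coefficient of ['X^i] is [f i.+1]. *)
Let p : {poly R[i]} := \poly_(i < n) f i.+1 xh.
Let q : {poly R[i]} := \poly_(i < n) (f i.+1 xh)^*%C.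

Lemma conj_horner_real (s : R) : (p.[s%:C])^*%C = q.[s%:C].
Proof.
rewrite !horner_poly (rmorph_sum (@conjc R)); apply: eq_bigr => i _.
by rewrite (rmorphM (@conjc R)) -rmorphXn /= oppr0.
Qed.

Lemma coef_quadratic i : (i < n)%N ->
  ('X * (p * q))`_i = \sum_(1 <= l < i.+1) f l xh * (f (i.+1 - l)%N xh)^*%C.
Proof.
move=> i_n; rewrite coefXM; case: i i_n => [|i] i_n; first by rewrite big_geq.
rewrite coefM big_add1 /= big_mkord; apply: eq_bigr => -[l li] _ /=.
have ln : (l < n)%N := ltn_trans li i_n.
have iln : (i - l < n)%N := leq_ltn_trans (leq_subr l i) (ltnW i_n).
by rewrite !coef_poly ln iln subSS subSn.
Qed.

Lemma scattered_field_ray : exists C s0, [/\ 0 <= C, 1 <= s0 & forall s, s0 <= s ->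
  exists2 h, normc h <= C * s^-1 ^+ n &
    us (s *: xh) = cexpi (k * s) / s%:C * (p.[s^-1%:C] + h)].
Proof.
have [g [M [r rP]] [r' r'P]] := f_atkinson n_gt0.
have [A [r'' r''P]] := remainder n.+1.
pose s0 := Num.max r (Num.max r' (Num.max r'' 1)).
exists (`|M| + `|A|), s0; split; first by rewrite addr_ge0.
  by rewrite !le_max lexx !orbT.
move=> s; rewrite !ge_max => /and4P[rs r's r''s s1].
have s_gt0 : 0 < s by exact: lt_le_trans s1.
have sE : enorm (s *: xh) = s by rewrite enormZ_unit // ltW.
have := rP (s *: xh); have := r'P (s *: xh); have := r''P (s *: xh).
rewrite sE dirZ // => /(_ r''s) Hr /(_ r's) Hu /(_ rs) Hg.
set e := cexpi (k * s) in Hu *; have e1 : normc e = 1 by exact: normc_cexpi.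
have e0 : e != 0.
  apply/eqP => E; have := oner_neq0 R.
  by rewrite -e1 E ComplexField.Normc.normc0 eqxx.
have sC0 : s%:C != 0 :> R[i] by rewrite fmorph_eq0 gt_eqF.
set rem := us (s *: xh) - helmholtz_part k us (s *: xh) in Hr.
exists (g (s *: xh) + rem * (s%:C / e)).
  rewrite (le_trans (normc_triangle _ _)) // [leRHS]mulrDl lerD //.
    rewrite exprVn; apply: (le_trans Hg).
    by apply: ler_wpM2r; [rewrite invr_ge0 exprn_ge0 // ltW|exact: ler_norm].
  rewrite !ComplexField.Normc.normcM ComplexField.Normc.normcV e1 invr1 mulr1.
  rewrite normcR.
  rewrite ger0_norm ?(ltW s_gt0) //.
  have z0 : 0 <= s^-1 by rewrite invr_ge0 ltW.
  have z1 : s^-1 <= 1 by rewrite invf_le1.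
  apply: (@le_trans _ _ (`|A| * s^-1 ^+ n.+1 * s)).
    rewrite ler_wpM2r ?(ltW s_gt0) // (le_trans Hr) //.
    apply: (@le_trans _ _ (`|A| * s^-1 ^+ (2 * n.+1))).
      by rewrite ler_wpM2r ?ler_norm // exprn_ge0.
    by rewrite ler_wpM2l // ler_wiXn2l // leq_pmull.
  by rewrite exprSr -!mulrA mulVf ?gt_eqF // mulr1.
have -> : us (s *: xh) = helmholtz_part k us (s *: xh) + rem.
  by rewrite /rem addrC subrK.
rewrite Hu [in RHS]addrA [in RHS]mulrDr; congr (_ + _); last first.
  by rewrite mulrCA; rewrite -[LHS]mulr1; congr (_ * _); field; rewrite e0.
congr (_ * (_ + _)); rewrite horner_poly big_add1 /= big_mkord.
apply: eq_bigr => i _; congr (_ * _).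
by rewrite -rmorphXn -fmorphV exprVn.
Qed.

(** With [z = 1 / s] and [P + h] the bracket in [scattered_field_ray], the data
    are [e * (P + h)] plus its conjugate plus [z * `|P + h| ^+ 2]. *)
Lemma phaseless_expansion : exists C s0, [/\ 0 <= C, 1 <= s0 & forall s, s0 <= s ->
  normc ((s * (normc (total_field k d us (s *: xh)) ^+ 2 - 1))%:C -
    \sum_(i < n)
      phaseless_coef (cexpi (s * k * (1 - dot xh d))) i.+1 * s^-1%:C ^+ i)
  <= C * s^-1 ^+ n].
Proof.
have [C1 [s0 [C10 s01 ray]]] := scattered_field_ray.
have [K K0 tail] := horner_tail ('X * (p * q)) n.
pose S := \sum_(i < size p) normc p`_i.
have S0 : 0 <= S by apply: sumr_ge0 => i _; exact: normc_ge0.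
exists (2 * C1 + (2 * S * C1 + C1 * C1) + K), s0; split=> //.
  by rewrite !addr_ge0 // !mulr_ge0.
move=> s s0s; have [h hC usE] := ray s s0s.
have s1 : 1 <= s by exact: le_trans s0s.
have s_gt0 : 0 < s by exact: lt_le_trans s1.
have z0 : 0 <= s^-1 by rewrite invr_ge0 ltW.
have z1 : s^-1 <= 1 by rewrite invf_le1.
set z : R[i] := s^-1%:C in usE *.
have nz : normc z = s^-1 by rewrite normcR ger0_norm.
set P := p.[z] in usE *.
have PS : normc P <= S by apply: horner_bounded; rewrite nz.
set e := cexpi (s * k * (1 - dot xh d)).
pose e1 := cexpi (k * dot (s *: xh) d).
have e1K : e1 * e1^*%C = 1 by exact: cexpiMconj.
have eE : cexpi (k * s) = e * e1.
  rewrite /e /e1 -cexpiD dotZl; congr cexpi; ring.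
have e1n : normc e = 1 by exact: normc_cexpi.
have zE : s%:C^-1 = z by rewrite /z fmorphV.
have zc : z^*%C = z by rewrite /z /= oppr0.
have sz : s%:C * z = 1 by rewrite /z -rmorphM /= divff ?gt_eqF.
have normE (w : R[i]) : (normc w ^+ 2)%:C = w * w^*%C.
  case: w => a b /=; rewrite sqr_sqrtr ?addr_ge0 ?sqr_ge0 //.
  by apply/eqP; rewrite eq_complex /=; apply/andP; split; apply/eqP; ring.
have main : (s * (normc (total_field k d us (s *: xh)) ^+ 2 - 1))%:C =
    e * (P + h) + (e * (P + h))^*%C + z * ((P + h) * (P + h)^*%C).
  rewrite rmorphM rmorphB /= normE /total_field /plane_wave -/e1 usE eE zE.
  rewrite rmorph1; apply: interference_identity => //; exact: cexpiMconj.
have Pc : P^*%C = q.[z] by exact: conj_horner_real.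
have sumE (a : R[i]) : \sum_(i < n) phaseless_coef a i.+1 * z ^+ i =
    a * P + (a * P)^*%C + \sum_(i < n) ('X * (p * q))`_i * z ^+ i.
  rewrite conjcM Pc /P !horner_poly !mulr_sumr -!big_split /=.
  apply: eq_bigr => i _; rewrite coef_quadratic // /phaseless_coef conjcM.
  by ring.
have qE : ('X * (p * q)).[z] = z * (P * P^*%C).
  by rewrite !hornerM hornerX Pc.
have := tail z; rewrite nz => /(_ z1).
set T := _ - _ => TK.
have -> : (s * (normc (total_field k d us (s *: xh)) ^+ 2 - 1))%:C -
    \sum_(i < n) phaseless_coef e i.+1 * z ^+ i =
    e * h + (e * h)^*%C + z * (P * h^*%C + h * P^*%C + h * h^*%C) + T.
  rewrite main sumE /T qE !(conjcD, conjcM); ring.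
have hC1 : normc h <= C1.
  by rewrite (le_trans hC) // ler_piMr // exprn_ile1.
have h0 := normc_ge0 h; have P0 := normc_ge0 P.
have Y0 : 0 <= s^-1 ^+ n by rewrite exprn_ge0.
have -> : (2 * C1 + (2 * S * C1 + C1 * C1) + K) * s^-1 ^+ n =
  2 * C1 * s^-1 ^+ n + (2 * S * C1 * s^-1 ^+ n + C1 * C1 * s^-1 ^+ n) +
  K * s^-1 ^+ n by ring.
rewrite (le_trans (normc_triangle _ _)) // lerD //.
rewrite (le_trans (normc_triangle _ _)) // lerD //.
  rewrite (le_trans (normc_triangle _ _)) // normc_conj.
  rewrite ComplexField.Normc.normcM e1n mul1r.
  by move: hC; lra.
rewrite ComplexField.Normc.normcM nz.
have X0 : 0 <= 2 * S * C1 * s^-1 ^+ n + C1 * C1 * s^-1 ^+ n.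
  by rewrite addr_ge0 // !mulr_ge0.
apply: (@le_trans _ _ (1 * (2 * S * C1 * s^-1 ^+ n + C1 * C1 * s^-1 ^+ n)));
  last by rewrite mul1r.
apply: ler_pM => //; first exact: normc_ge0.
rewrite (le_trans (normc_triangle _ _)) // lerD //; last first.
  by rewrite ComplexField.Normc.normcM normc_conj -mulrA ler_pM.
rewrite (le_trans (normc_triangle _ _)) // !ComplexField.Normc.normcM !normc_conj.
have PH : normc P * normc h <= S * (C1 * s^-1 ^+ n) by apply: ler_pM.
by move: PH; rewrite [normc h * _]mulrC; lra.
Qed.

End PhaselessExpansion.

(** * Vandermonde systems with nearly fixed nodes *)

Section PerturbedSystem.
Context {R : realType} {n : nat}.

Lemma unitmx_trivial_kernel (Y : 'M[R]_n) :
  (forall x : 'cV[R]_n, Y *m x = 0 -> x = 0) -> Y \in unitmx.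
Proof.
move=> Y0; rewrite -unitmx_tr -row_free_unit -kermx_eq0; apply/rowV0P => v.
move=> /sub_kermxP vY; apply: trmx_inj; rewrite trmx0; apply: Y0.
by apply: trmx_inj; rewrite trmx_mul trmxK trmx0.
Qed.

(** If [Y] is close to an invertible [P], then [Y z] bounds [z], with a constant
    that depends only on [P]: [z = P^-1 (Y z - (Y - P) z)], and the last term is
    absorbed. *)
Lemma perturbed_system (P : 'M[R]_n) : P \in unitmx -> exists K eps, 0 < eps /\
  forall (Y : 'M[R]_n) (z : 'I_n -> R[i]) b,
    (forall i j, `|Y i j - P i j| <= eps) ->
    (forall i, normc (\sum_j (Y i j)%:C * z j) <= b) ->
    forall j, normc (z j) <= K * b.
Proof.
move=> Punit; pose Q := invmx P.
pose L := \sum_l \sum_i `|Q l i|.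
have L0 : 0 <= L by apply: sumr_ge0 => l _; apply: sumr_ge0.
pose eps := (2 * (L + 1))^-1.
have eps0 : 0 < eps by rewrite invr_gt0 mulr_gt0 // ltr_wpDl.
exists (2 * L), eps; split=> // Y z b YP Yz.
pose Z := \sum_j normc (z j).
have zZ j : normc (z j) <= Z.
  by rewrite /Z (bigD1 j) //= lerDl sumr_ge0 // => i _; exact: normc_ge0.
have Z0 : 0 <= Z by apply: sumr_ge0 => i _; exact: normc_ge0.
have Pz i : normc (\sum_j (P i j)%:C * z j) <= b + eps * Z.
  have -> : \sum_j (P i j)%:C * z j =
      \sum_j (Y i j)%:C * z j - \sum_j (Y i j - P i j)%:C * z j.
    rewrite -sumrB; apply: eq_bigr => j _.
    by rewrite -mulrBl -rmorphB /= opprB addrC subrK.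
  rewrite (le_trans (normc_triangle _ _)) // lerD // normc_opp.
  rewrite (le_trans (normc_sum _ _ _)) // /Z mulr_sumr ler_sum // => j _.
  by rewrite ComplexField.Normc.normcM normcR ler_wpM2r ?normc_ge0.
have zE l : z l = \sum_i (Q l i)%:C * (\sum_j (P i j)%:C * z j).
  under eq_bigr do rewrite mulr_sumr.
  rewrite exchange_big /= (bigD1 l) //= [X in _ + X]big1 => [|j jl].
    rewrite addr0; under eq_bigr do rewrite mulrA -rmorphM.
    rewrite -mulr_suml -rmorph_sum /=.
    have := congr1 (fun M : 'M[R]_n => M l l) (mulVmx Punit).
    by rewrite !mxE eqxx => ->; rewrite rmorph1 mul1r.
  under eq_bigr do rewrite mulrA -rmorphM.
  rewrite -mulr_suml -rmorph_sum /=.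
  have := congr1 (fun M : 'M[R]_n => M l j) (mulVmx Punit).
  by rewrite !mxE eq_sym (negbTE jl) => ->; rewrite rmorph0 mul0r.
have ZL : Z <= L * (b + eps * Z).
  rewrite /L mulr_suml; apply: ler_sum => l _; rewrite {1}zE mulr_suml.
  rewrite (le_trans (normc_sum _ _ _)) // ler_sum // => i _.
  by rewrite ComplexField.Normc.normcM normcR ler_wpM2l.
have Leps : L * eps * Z <= 2^-1 * Z.
  rewrite ler_wpM2r // /eps invfM mulrCA ler_piMr ?invr_ge0 //.
  by rewrite ler_pdivrMr ?ltr_wpDl // mul1r lerDl.
move=> j; rewrite (le_trans (zZ j)) //.
by move: ZL Leps; rewrite mulrDr mulrA; lra.
Qed.

End PerturbedSystem.

Section Nodes.
Context {R : realType}.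
Variables (n : nat) (sigma : nat -> R).
Hypothesis sigma_gt0 : forall j, (1 <= j <= n)%N -> 0 < sigma j.
Hypothesis sigma_inj : forall i j, (1 <= i <= n)%N -> (1 <= j <= n)%N ->
  sigma i = sigma j -> i = j.
(* The nodes [s t j] stay at bounded distance from [sigma j * t]. *)
Variables (s : R -> nat -> R) (Bc : R).
Hypothesis s_near : forall t j, 0 < t -> (1 <= j <= n)%N ->
  `|s t j - sigma j * t| <= Bc.

Lemma node_ratio_cvg j : (1 <= j <= n)%N ->
  t / s t j @[t --> +oo] --> (sigma j)^-1.
Proof.
move=> jn; have sj := sigma_gt0 jn.
have cv : s t j / t @[t --> +oo] --> sigma j.
  apply/cvgrPdist_le => e e0; near=> t.
  have t0 : 0 < t by near: t; exact: nbhs_pinfty_gt.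
  have tB : Bc / e <= t by near: t; apply: nbhs_pinfty_ge; exact: num_real.
  have -> : sigma j - s t j / t = - ((s t j - sigma j * t) / t).
    by field; rewrite gt_eqF.
  rewrite normrN normrM normfV (gtr0_norm t0) ler_pdivrMr //.
  by rewrite (le_trans (s_near t0 jn)) // mulrC -ler_pdivrMr.
have -> : (fun t => t / s t j) = (fun t => (s t j / t)^-1).
  by apply/funext => t; rewrite invf_div.
exact: cvgV (lt0r_neq0 sj) cv.
Unshelve. all: by end_near. Qed.

Lemma node_large j r : (1 <= j <= n)%N -> \forall t \near +oo, r <= s t j.
Proof.
move=> jn; have sj := sigma_gt0 jn; near=> t.
have t0 : 0 < t by near: t; exact: nbhs_pinfty_gt.
have := s_near t0 jn => /ler_normlP[+ _].
have : (r + Bc) / sigma j <= t by near: t; apply: nbhs_pinfty_ge; exact: num_real.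
by rewrite ler_pdivrMr // mulrC; lra.
Unshelve. all: by end_near. Qed.

Let P : 'M[R]_n := \matrix_(i < n, j < n) (sigma i.+1)^-1 ^+ j.

Lemma limit_nodes_unit : P \in unitmx.
Proof.
have -> : P = (Vandermonde n (\row_(i < n) (sigma i.+1)^-1))^T.
  by apply/matrixP => i j; rewrite !mxE.
rewrite unitmx_tr unitmxE det_Vandermonde unitfE.
apply/prodf_neq0 => i _; apply/prodf_neq0 => j ij; rewrite !mxE subr_eq0.
apply/negP => /eqP /invr_inj E; have := sigma_inj _ _ E.
rewrite !ltnS !leq0n !ltn_ord => /(_ isT isT)[ji].
by move: ij; rewrite ji ltnn.
Qed.

Lemma node_powers_near eps : 0 < eps -> \forall t \near +oo,
  forall i : 'I_n, forall m : 'I_n.+1,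
    `|(t / s t i.+1) ^+ m - (sigma i.+1)^-1 ^+ m| <= eps.
Proof.
move=> e0; apply: (@filter_forall _ _ (fun (i : 'I_n) t => forall m : 'I_n.+1,
  `|(t / s t i.+1) ^+ m - (sigma i.+1)^-1 ^+ m| <= eps)) => i.
apply: (@filter_forall _ _ (fun (m : 'I_n.+1) t =>
  `|(t / s t i.+1) ^+ m - (sigma i.+1)^-1 ^+ m| <= eps)) => m.
have iN : (1 <= i.+1 <= n)%N by rewrite /= ltn_ord.
have cv : (t / s t i.+1) ^+ m @[t --> +oo] --> (sigma i.+1)^-1 ^+ m.
  exact: (continuous_cvg _ (@exprn_continuous R m _) (node_ratio_cvg iN)).
have /cvgrPdist_le/(_ _ e0) := cv.
by apply: filterS => t; rewrite distrC.
Qed.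

(** Scaling the [l]-th unknown by [t ^- l] turns the matrix of the [s_i ^- l]
    into that of the [(t / s_i) ^ l], which converges to an invertible matrix.
    Scaling back costs [t ^ j] for the unknown number [j] (counted from 0). *)
Lemma vandermonde_recovery (data : R -> 'cV[R]_n) (G : R -> nat -> R[i]) (C : R) :
  (\forall t \near +oo, forall i : 'I_n,
    normc ((data t i 0)%:C - \sum_(j < n) G t j.+1 * (s t i.+1)^-1%:C ^+ j)
    <= C * (s t i.+1)^-1 ^+ n) ->
  forall j : 'I_n, decays (n - j) (fun t =>
    G t j.+1 - ((invmx (Vmatrix n (s t)) *m data t) j 0)%:C).
Proof.
move=> dataG; have [K [eps [eps0 KP]]] := perturbed_system limit_nodes_unit.
pose B := 1 + \sum_(i < n) (sigma i.+1)^-1 ^+ n.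
move=> j; exists (K * (`|C| * B)); near=> t.
have t0 : 0 < t by near: t; exact: nbhs_pinfty_gt.
have tC0 : t%:C != 0 by rewrite fmorph_eq0 gt_eqF.
pose Y : 'M[R]_n := \matrix_(a < n, b < n) (t / s t a.+1) ^+ b.
have YP : forall a b, `|Y a b - P a b| <= eps.
  move=> a b; rewrite !mxE; suff : forall i : 'I_n, forall m : 'I_n.+1,
    `|(t / s t i.+1) ^+ m - (sigma i.+1)^-1 ^+ m| <= eps.
    by move=> /(_ a (widen_ord (leqnSn n) b)).
  by near: t; exact: node_powers_near.
have Yn : forall a : 'I_n, (t / s t a.+1) ^+ n <= B.
  move=> a; have : `|(t / s t a.+1) ^+ n - (sigma a.+1)^-1 ^+ n| <= 1.
    suff : forall i : 'I_n, forall m : 'I_n.+1,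
      `|(t / s t i.+1) ^+ m - (sigma i.+1)^-1 ^+ m| <= 1 by move=> /(_ a ord_max).
    by near: t; exact: node_powers_near.
  move=> /ler_normlP[_]; rewrite lerBlDr => /le_trans; apply.
  rewrite /B lerD2l (bigD1 a) //= lerDl sumr_ge0 // => i _.
  by rewrite exprn_ge0 // invr_ge0 ltW // sigma_gt0 //= ltn_ord.
(* The bound for the right-hand side 0 shows that the kernel is trivial. *)
have V_unit : Vmatrix n (s t) \in unitmx.
  apply: unitmx_trivial_kernel => x Vx; apply/matrixP => l o; rewrite ord1 [RHS]mxE.
  have := KP Y (fun l => (x l 0 * t ^- l)%:C) 0 YP _ l.
  rewrite mulr0 => H; have {}H : normc (x l 0 * t ^- l)%:C <= 0.
    apply: H => a; have := congr1 (fun M : 'cV[R]_n => M a 0) Vx.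
    rewrite mxE [RHS]mxE => Vxa.
    rewrite (eq_bigr (fun j : 'I_n => (Vmatrix n (s t) a j * x j 0)%:C)) => [|b _].
      by rewrite -rmorph_sum Vxa rmorph0 ComplexField.Normc.normc0.
    rewrite !mxE -rmorphM /= exprMn exprVn; congr (_%:C).
    have T0 : t ^+ b != 0 by rewrite expf_neq0 // gt_eqF.
    by move: (s t a.+1 ^- b) (t ^+ b) T0 => J T T0; field.
  move: H; rewrite normcR normr_le0 mulf_eq0 invr_eq0 expf_eq0 (gt_eqF t0) andbF orbF.
  by move/eqP.
set F := invmx _ *m _; have VF : Vmatrix n (s t) *m F = data t by rewrite mulKVmx.
pose z (l : 'I_n) := (G t l.+1 - (F l 0)%:C) * (t ^- l)%:C.
have := KP Y z (`|C| * B * t ^- n) YP _ j.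
have zb a : normc (\sum_l (Y a l)%:C * z l) <= `|C| * B * t ^- n.
  have aN : (1 <= a.+1 <= n)%N by rewrite /= ltn_ord.
  have sa0 : 0 < s t a.+1.
    have : 1 <= s t a.+1.
      suff : forall i : 'I_n, 1 <= s t i.+1 by [].
      near: t; apply: (@filter_forall _ _ (fun (i : 'I_n) t => 1 <= s t i.+1)) => i.
      by apply: node_large; rewrite /= ltn_ord.
    by move=> /(lt_le_trans ltr01).
  have -> : \sum_l (Y a l)%:C * z l =
      - ((data t a 0)%:C - \sum_(j < n) G t j.+1 * (s t a.+1)^-1%:C ^+ j).
    rewrite -VF mxE rmorph_sum -sumrB -sumrN; apply: eq_bigr => l _.
    pose T := (t ^+ l)%:C; pose S := ((s t a.+1)^-1 ^+ l)%:C; pose J := (t ^- l)%:C.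
    have YE : (Y a l)%:C = T * S by rewrite mxE exprMn rmorphM.
    have VE : (Vmatrix n (s t) a l)%:C = S by rewrite mxE -exprVn.
    have TJ : T * J = 1 by rewrite -rmorphM /= divff // expf_neq0 // gt_eqF.
    rewrite YE /z rmorphM /= VE -rmorphXn /= -/S -/J.
    move: T S J (G t l.+1) (F l 0)%:C {YE VE} TJ => T S J g f TJ.
    transitivity ((T * J) * (S * (g - f))); first by ring.
    by rewrite TJ; ring.
  rewrite normc_opp.
  apply: (@le_trans _ _ (C * (s t a.+1)^-1 ^+ n)).
    by move: a {aN sa0}; near: t.
  apply: (@le_trans _ _ (`|C| * (s t a.+1)^-1 ^+ n)).
    by rewrite ler_wpM2r ?ler_norm // exprn_ge0 // invr_ge0 ltW.
  rewrite -mulrA ler_wpM2l // ler_pdivlMr ?exprn_gt0 // mulrC -exprMn; exact: Yn.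
move=> /(_ zb); rewrite ComplexField.Normc.normcM normcR ger0_norm; last first.
  by rewrite invr_ge0 exprn_ge0 // ltW.
rewrite ler_pdivrMr ?exprn_gt0 // => H; rewrite (le_trans H) //.
have -> : t ^- n = t ^- (n - j) * t ^- j.
  by rewrite -invfM -exprD subnK // ltnW.
by rewrite -!mulrA mulVf ?mulr1 // expf_neq0 // gt_eqF.
Unshelve. all: by end_near. Qed.

End Nodes.

(** * The phase retrieval recursion *)

Section Periodicity.
Context {R : realType}.

Lemma cexpi_period (a : R) (l : int) : cexpi (a + 2 * l%:~R * pi) = cexpi a.
Proof.
have nat_period (b : R) n : cexpi (b + 2 * n%:R * pi) = cexpi b.
  have -> : b + 2 * n%:R * pi = b + pi *+ 2 *+ n.
    by rewrite -(mulr_natl (_ *+ 2)) -(mulr_natl pi 2); ring.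
  by rewrite /cexpi (periodicn (@cosD2pi R)) (periodicn (@sinD2pi R)).
case: l => n; first exact: nat_period.
rewrite -[in RHS](subrK (2 * n.+1%:R * pi) a) nat_period; congr cexpi.
by rewrite NegzE mulrNz; ring.
Qed.

Lemma sin_eq0_int (a : R) : sin a = 0 -> exists l : int, a = l%:~R * pi.
Proof.
move=> sa0.
have nat_shift (b : R) n : sin b = 0 -> sin (b + n%:R * pi) = 0.
  move=> sb; elim: n => [|n IH]; first by rewrite mul0r addr0.
  have -> : b + n.+1%:R * pi = b + n%:R * pi + pi by rewrite -natr1; ring.
  by rewrite sinDpi IH oppr0.
have nat_shiftN (b : R) n : sin b = 0 -> sin (b - n%:R * pi) = 0.
  move=> sb; elim: n => [|n IH]; first by rewrite mul0r subr0.
  have E : b - n%:R * pi = b - n.+1%:R * pi + pi by rewrite -natr1; ring.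
  by move: IH; rewrite E sinDpi => /eqP; rewrite oppr_eq0 => /eqP.
have pi0 := @pi_gt0 R.
pose l := Num.floor (a / pi); exists l.
have [r0 r1] : 0 <= a - l%:~R * pi /\ a - l%:~R * pi < pi.
  have := floor_itv (a / pi); rewrite -/l intrD1 => /andP[].
  rewrite ler_pdivlMr // ltr_pdivrMr // => h1 h2; split; lra.
have sr : sin (a - l%:~R * pi) = 0.
  case: (l) => n; first exact: nat_shiftN.
  by rewrite NegzE mulrNz mulNr opprK; exact: nat_shift.
move: r0; rewrite le_eqVlt => /orP[/eqP r0|r0]; first by move: r0; lra.
by have := @sin_gt0_pi R _ (introT andP (conj r0 r1)); rewrite sr ltxx.
Qed.

End Periodicity.

Section PhaseRetrieval.
Context {R : realType}.

(** The real parts of [e * z] and of [e * e1 * z] control [z] as soon as [e1] is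
    not real: eliminate the conjugate of [e * z]. *)
Lemma phase_retrieval_bound (e e1 z w w' : R[i]) :
  e * e^*%C = 1 -> e * z + (e * z)^*%C = w ->
  e * e1 * z + (e * e1 * z)^*%C = w' ->
  normc e1 = 1 -> normc z * normc (e1 - e1^*%C) <= normc w + normc w'.
Proof.
move=> ee w1E w2E e1n.
have en : normc e = 1.
  have := congr1 (fun x => normc x) ee.
  rewrite ComplexField.Normc.normcM normc_conj ComplexField.Normc.normc1 => /eqP.
  rewrite -expr2 sqrf_eq1 => /orP[/eqP//|/eqP E].
  by have := normc_ge0 e; rewrite E oppr_ge0 ler10.
have E : (e1 - e1^*%C) * (e * z) = w' - e1^*%C * w.
  by rewrite -w1E -w2E !conjcM; ring.
rewrite -[normc z]mul1r -en -ComplexField.Normc.normcM mulrC.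
rewrite -ComplexField.Normc.normcM E.
rewrite (le_trans (normc_triangle _ _)) // normc_opp ComplexField.Normc.normcM.
by rewrite normc_conj e1n mul1r addrC.
Qed.

Section Recursion.
Variables (n : nat) (k mu tau : R) (s : R -> R).
Hypothesis tau_generic : sin (tau * k * (1 - mu)) != 0.
Variables (F F' : R -> 'cV[R]_n).
Variables (f : nat -> 'rV[R]_3 -> R[i]) (xh : 'rV[R]_3).

Let g t := recovered k mu (s t) (s t + tau) (F t) (F' t).
Let e t := cexpi (s t * k * (1 - mu)).
Let e' t := cexpi ((s t + tau) * k * (1 - mu)).

(** The two rows of the 2 x 2 systems that define the recursion. *)
Lemma recovered_system t j : (0 < j)%N ->
  e t * g t j + (e t * g t j)^*%C = Wcoef (F t) (g t) j /\
  e' t * g t j + (e' t * g t j)^*%C = Wcoef (F' t) (g t) j.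
Proof.
move=> j0; set M := phase_matrix k mu (s t) (s t + tau).
have Mu : M \in unitmx by exact: phase_matrix_unit.
have /(congr1 (mulmx M)) := recoveredE (s t) (F t) (F' t) tau_generic j0.
rewrite mulKVmx // -/(g t) => E.
have conjE (a : R) : cexpi (a * k * (mu - 1)) = (cexpi (a * k * (1 - mu)))^*%C.
  by rewrite -cexpiN; congr cexpi; ring.
split; rewrite conjcM.
  have := congr1 (fun A : 'cV[R[i]]_2 => A 0 0) E.
  by rewrite mxE !big_ord_recl big_ord0 !mxE /= addr0 conjE.
have := congr1 (fun A : 'cV[R[i]]_2 => A 1 0) E.
by rewrite mxE !big_ord_recl big_ord0 !mxE /= addr0 conjE.
Qed.

Hypothesis F_decays : forall j, (1 <= j <= n)%N ->
  decays (n.+1 - j) (fun t => phaseless_coef f xh (e t) j - (entry (F t) j)%:C).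
Hypothesis F'_decays : forall j, (1 <= j <= n)%N ->
  decays (n.+1 - j) (fun t => phaseless_coef f xh (e' t) j - (entry (F' t) j)%:C).

(** The error [f_j - g_j] satisfies the same two equations, with right-hand
    sides made of the errors of the Vandermonde systems and of the quadratic
    terms [S], which only involve smaller indices. *)
Lemma recursion_decays j : (1 <= j <= n)%N ->
  decays (n.+1 - j) (fun t => f j xh - g t j).
Proof.
have [J] := ubnP j; elim: J j => // J IH j jJ /andP[j1 jn].
pose S t := \sum_(1 <= l < j)
  (f l xh * (f (j - l)%N xh)^*%C - g t l * (g t (j - l)%N)^*%C).
have S_decays : decays (n.+1 - j) S.
  apply: decays_sum => l /andP[l1 lj].
  have lJ : (l < J)%N by rewrite (leq_trans lj).
  have ln : (1 <= l <= n)%N by rewrite l1 (leq_trans (ltnW lj)).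
  have jl1 : (1 <= j - l)%N by rewrite subn_gt0.
  have jlj : (j - l < j)%N by rewrite ltn_subrL l1 (leq_trans _ j1).
  have Dl := IH l lJ ln.
  have Djl : decays (n.+1 - (j - l)) (fun t => f (j - l)%N xh - g t (j - l)%N).
    apply: IH; first by rewrite (leq_trans jlj).
    by rewrite jl1 (leq_trans (ltnW jlj)).
  have gl : decays 0 (fun t => g t l).
    apply: (@decays_eq _ _ (fun t => f l xh + - (f l xh - g t l))).
      by near=> t; ring.
    by apply: decaysD; [exact: decays_cst|apply/decaysN/(decays_le (leq0n _) Dl)].
  apply: (@decays_eq _ _ (fun t => (f l xh - g t l) * (f (j - l)%N xh)^*%C +
      g t l * (f (j - l)%N xh - g t (j - l)%N)^*%C)).
    by near=> t; rewrite conjcD conjcN; ring.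
  apply: decaysD.
    apply: (@decays_le _ _ (n.+1 - l + 0)).
      by rewrite addn0 leq_sub2l // ltnW.
    by apply: decaysM Dl _; exact: decays_cst.
  apply: (@decays_le _ _ (0 + (n.+1 - (j - l)))).
    by rewrite add0n leq_sub2l // leq_subr.
  exact/(decaysM gl)/decays_conj.
pose w t := phaseless_coef f xh (e t) j - (entry (F t) j)%:C - S t.
pose w' t := phaseless_coef f xh (e' t) j - (entry (F' t) j)%:C - S t.
have w_decays : decays (n.+1 - j) w.
  by apply: decaysD; [apply: F_decays; rewrite j1|exact: decaysN].
have w'_decays : decays (n.+1 - j) w'.
  by apply: decaysD; [apply: F'_decays; rewrite j1|exact: decaysN].
pose e1 := cexpi (tau * k * (1 - mu)).
have N0 : 0 < normc (e1 - e1^*%C).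
  rewrite lt_neqAle normc_ge0 andbT eq_sym.
  apply/eqP => /ComplexField.Normc.eq0_normc.
  move=> /eqP; rewrite eq_complex /= => /andP[_].
  by rewrite opprK -mulr2n mulrn_eq0 /=; apply/negP.
have e'E t : e' t = e t * e1 by rewrite /e' /e /e1 -cexpiD; congr cexpi; ring.
have bound t : normc (f j xh - g t j) * normc (e1 - e1^*%C) <=
    normc (w t) + normc (w' t).
  have [sys sys'] := recovered_system t j1.
  have SE : S t = \sum_(1 <= l < j) f l xh * (f (j - l)%N xh)^*%C -
      \sum_(1 <= l < j) g t l * (g t (j - l)%N)^*%C by rewrite /S sumrB.
  apply: (@phase_retrieval_bound (e t)); [exact: cexpiMconj| | |exact: normc_cexpi].
    rewrite mulrBr conjcD conjcN addrACA -opprD sys.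
    by rewrite /w SE /phaseless_coef /Wcoef; ring.
  rewrite -e'E mulrBr conjcD conjcN addrACA -opprD sys'.
  by rewrite /w' SE /phaseless_coef /Wcoef; ring.
have [M M0 wM] := decaysP w_decays; have [M' M'0 w'M] := decaysP w'_decays.
exists ((M + M') / normc (e1 - e1^*%C)); near=> t.
rewrite mulrAC ler_pdivlMr // (le_trans (bound t)) // mulrDl lerD //.
  by near: t.
by near: t.
Unshelve. all: by end_near. Qed.

End Recursion.
End PhaseRetrieval.

(** * The recovery formula *)

Theorem theorem4p3 (R : realType)
    (k : R) (k_gt0 : 0 < k)
    (al : R) (al_gt0 : 0 < al) (al_le1 : al <= 1)
    (D : set 'rV[R]_3) (D_obstacle : obstacle al D)
    (nu : 'rV[R]_3 -> 'rV[R]_3)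
    (nu_normal : forall x, bdry D x -> exterior_unit_normal al D x (nu x))
    (d : 'rV[R]_3) (d_unit : enorm d = 1)
    (B : boundary_condition)
    (us : 'rV[R]_3 -> R[i]) (us_C4 : cclass_C 4 (exterior D) us)
    (u_wave : biharmonic_wave k (exterior D) (total_field k d us))
    (u_bc : satisfies_bc D nu B (total_field k d us))
    (us_radiating : radiating k us)
    (f : nat -> 'rV[R]_3 -> R[i])
    (f_atkinson : atkinson_coefficients k f (helmholtz_part k us))
    (n : nat) (n_gt0 : (0 < n)%N)
    (sigma : nat -> R)
    (sigma_gt0 : forall j, (1 <= j <= n)%N -> 0 < sigma j)
    (sigma_inj : forall i j, (1 <= i <= n)%N -> (1 <= j <= n)%N ->
       sigma i = sigma j -> i = j)
    (xh : 'rV[R]_3) (xh_unit : enorm xh = 1) (xh_neq_d : xh <> d)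
    (tau : R)
    (tau_generic : forall l : int,
       tau <> l%:~R * pi / (k * (1 - dot xh d)))
    (c : nat -> R -> R) (c1 : R) (c1_ge0 : 0 <= c1)
    (c_first : forall t, 0 < t -> c 1%N t = c1)
    (c_range : forall j t, (2 <= j <= n)%N -> 0 < t ->
       0 <= c j t < 2 * pi / (k * (1 - dot xh d)))
    (c_lattice : forall j t, (2 <= j <= n)%N -> 0 < t ->
       exists l : int,
         (sigma j * t + c j t) - (sigma 1%N * t + c 1%N t) =
         2 * l%:~R * pi / (k * (1 - dot xh d))) :
  let u := total_field k d us in
  let t_ (t : R) (j : nat) := sigma j * t + c j t in
  let tt_ (t : R) (j : nat) := t_ t j + tau in
  let F t := Fvec n (t_ t) u xh in
  let Ft t := Fvec n (tt_ t) u xh in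
  let ft j t :=
    recovered k (dot xh d) (t_ t 1%N) (t_ t 1%N + tau) (F t) (Ft t) j in
  forall j, (1 <= j <= n)%N ->
    bigO_at +oo (fun t => f j xh - ft j t) (fun t => t ^- (n.+1 - j)) /\
    bigO_at +oo (fun t => (f j xh)^* - (ft j t)^*) (fun t => t ^- (n.+1 - j)).
Proof.
move=> u t_ tt_ F Ft ft.
have [_ D_bounded _ _] := D_obstacle.
pose mu := dot xh d; pose kap := k * (1 - mu).
have mu_lt1 : mu < 1.
  have e2 : dot (xh - d) (xh - d) = 2 - 2 * mu.
    rewrite -(scaleN1r d) dotDl !dotDr !dotZl !dotZr -!sqr_enorm xh_unit d_unit.
    by rewrite (dotC d xh) -/mu; ring.
  have : dot (xh - d) (xh - d) != 0.
    by apply/eqP => /dot_eq0 /eqP; rewrite subr_eq0 => /eqP.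
  by have := dot_ge0 (xh - d); rewrite e2 le_eqVlt eq_sym => /orP[->//|]; lra.
have kap_gt0 : 0 < kap by rewrite mulr_gt0 // subr_gt0.
have sin_neq0 : sin (tau * k * (1 - mu)) != 0.
  apply/eqP => /sin_eq0_int[l lE]; apply: (tau_generic l).
  by rewrite -lE -/mu; field; rewrite !gt_eqF ?subr_gt0.
have [C [s0 [C0 s01 expansion]]] := phaseless_expansion d n_gt0 xh_unit f_atkinson
  (scattered_field_asymptotics k_gt0 D_bounded d_unit us_C4 u_wave us_radiating
    f_atkinson).
(* A common bound for all shifts [c_j]. *)
pose Bc := c1 + 2 * pi / kap.
have c_bounded t j : 0 < t -> (1 <= j <= n)%N -> `|c j t| <= Bc.
  move=> t0 /andP[j1 jn]; have pk : 0 <= 2 * pi / kap.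
    by rewrite divr_ge0 ?(ltW kap_gt0) // mulr_ge0 // pi_ge0.
  have [j2|] := leqP 2 j.
    have /andP[cj0 cj1] := c_range j t (introT andP (conj j2 jn)) t0.
    by rewrite ger0_norm // (le_trans (ltW cj1)) // lerDr.
  rewrite ltnS => j1'; have -> : j = 1%N by apply/eqP; rewrite eqn_leq j1 j1'.
  by rewrite c_first // ger0_norm // lerDl.
have t_near t j : 0 < t -> (1 <= j <= n)%N -> `|t_ t j - sigma j * t| <= Bc.
  by move=> t0 jn; rewrite /t_ addrAC subrr add0r c_bounded.
have tt_near t j : 0 < t -> (1 <= j <= n)%N ->
    `|tt_ t j - sigma j * t| <= Bc + `|tau|.
  move=> t0 jn; rewrite /tt_ addrAC (le_trans (ler_normD _ _)) // lerD2r.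
  exact: t_near.
pose e t := cexpi (t_ t 1%N * k * (1 - mu)).
pose e' t := cexpi (tt_ t 1%N * k * (1 - mu)).
(* By [c_lattice], the phase is the same at all nodes of one family. *)
have phase t j b : 0 < t -> (1 <= j <= n)%N ->
    cexpi ((t_ t j + b) * k * (1 - mu)) = cexpi ((t_ t 1%N + b) * k * (1 - mu)).
  move=> t0 /andP[j1 jn]; have [j2|] := leqP 2 j; last first.
    rewrite ltnS => j1'; congr (cexpi ((t_ t _ + b) * _ * _)).
    by apply/eqP; rewrite eqn_leq j1 j1'.
  have [l lE] := c_lattice j t (introT andP (conj j2 jn)) t0.
  rewrite -[RHS](cexpi_period _ l); congr cexpi.
  have -> : t_ t j = t_ t 1%N + 2 * l%:~R * pi / kap by rewrite -lE addrC subrK.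
  by rewrite /kap; field; rewrite !gt_eqF ?subr_gt0.
(* Both families of nodes are instances of this. *)
have recovery (s : R -> nat -> R) (a : R -> R[i]) (Bs : R) :
    (forall t j, 0 < t -> (1 <= j <= n)%N -> `|s t j - sigma j * t| <= Bs) ->
    (forall t j, 0 < t -> (1 <= j <= n)%N ->
      cexpi (s t j * k * (1 - mu)) = a t) ->
    forall j, (1 <= j <= n)%N -> decays (n.+1 - j)
      (fun t => phaseless_coef f xh (a t) j - (entry (Fvec n (s t) u xh) j)%:C).
  move=> s_near s_phase [//|j] /= jn.
  rewrite subSS.
  have := @vandermonde_recovery R n sigma sigma_gt0 sigma_inj s Bs s_near
    (fun t => phaseless_data n (s t) u xh) (fun t => phaseless_coef f xh (a t)) C.
  move=> /(_ _ (Ordinal jn)) H; apply: (decays_eq _ (H _)).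
    by near=> t; rewrite /entry /= insubT.
  near=> t => i; have iN : (1 <= i.+1 <= n)%N by rewrite /= ltn_ord.
  have t0 : 0 < t by near: t; exact: nbhs_pinfty_gt.
  have si : forall i : 'I_n, s0 <= s t i.+1.
    near: t; apply: (@filter_forall _ _ (fun (i : 'I_n) t => s0 <= s t i.+1)) => l.
    by apply: (node_large sigma_gt0 s_near); rewrite /= ltn_ord.
  by rewrite mxE; have := expansion _ (si i); rewrite -/mu s_phase.
have H1 := recovery t_ e Bc t_near.
have H2 := recovery tt_ e' (Bc + `|tau|) tt_near.
move=> j jn.
have ft_decays : decays (n.+1 - j) (fun t => f j xh - ft j t).
  apply: (recursion_decays sin_neq0 _ _ jn).
  - apply: H1 => t l t0 ln; have := phase t l 0 t0 ln; by rewrite !addr0.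
  - by apply: H2 => t l t0 ln; exact: phase.
split; first exact: ft_decays.
have := decays_conj ft_decays; apply: decays_eq; near=> t.
by rewrite conjcD conjcN.
Unshelve. all: by end_near. Qed.
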